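(* Let $\omega$ be a non-principal ultrafilter on $\mathbb N$. Let $(X,d,\mathfrak m)$ be a pointwise doubling Polish metric measure space with $\mathfrak m$ boundedly finite, and let $r_i\searrow0$ be given. For $p\in{\rm spt}(\mathfrak m)$ set $\mathfrak m^p_{r_i}:=\mathfrak m/\mathfrak m(B_d(p,r_i))$. Then for $\mathfrak m$-a.e. point $p\in X$ the sequence $\big((X,d/r_i,\mathfrak m^p_{r_i},p)\big)_{i\in\mathbb N}$ is asymptotically boundedly $\mathfrak m_\omega$-totally bounded. In particular, ${\rm Tan}(X,d,\mathfrak m,p)\ne\emptyset$ for $\mathfrak m$-a.e. $p\in X$.
   Context: $B(x,r)=B_d(x,r)$ and $\bar B(x,r)$ are open/closed balls; $A^r:=\{x:{\rm dist}(x,A)<r\}$. A Polish metric measure space is a complete separable metric space with a Borel measure; boundedly finite means finite on balls; ${\rm spt}(\mathfrak m):=\{x:\mathfrak m(B(x,r))>0\ \forall r>0\}$. ''For $\omega$-a.e. $i$'' means for all $i$ in some element of $\omega$. Pointwise doubling: $\limsup_{r\searrow0}\mathfrak m(B(x,2r))/\mathfrak m(B(x,r))<+\infty$ for $\mathfrak m$-a.e. $x\in X$. A sequence $\big((X_i,d_i,\mathfrak m_i,p_i)\big)$ of pointed metric measure spaces is asymptotically boundedly $\mathfrak m_\omega$-totally bounded if: for every $R>0$ there is $\eta(R)<+\infty$ with $\mathfrak m_i(B(p_i,R))\le\eta(R)$ for $\omega$-a.e. $i$; and for every $R,r,\varepsilon>0$ there are $M\in\mathbb N$ and points $(x^i_n)_{n=1}^M\subset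 X_i$ with $\lim_{i\to\omega}\mathfrak m_i\big(\bar B(p_i,R)\setminus\bigcup_{n=1}^MB(x^i_n,r)\big)\le\varepsilon$ (balls with respect to $d_i$). Weak $(R,\varepsilon)$-approximation ($0<\varepsilon<R$) from $(X,d_X,\mathfrak m_X,p_X)$ to $(Y,d_Y,\mathfrak m_Y,p_Y)$: a Borel map $\psi\colon B(p_X,R)\to Y$ with $\psi(p_X)=p_Y$ for which there is a Borel set $\tilde X\subset B(p_X,R)$ containing $p_X$ with (1) $|d_X(x,y)-d_Y(\psi(x),\psi(y))|\le\varepsilon$ for all $x,y\in\tilde X$; (2) $\mathfrak m_X(B(p_X,R)\setminus\tilde X)\le\varepsilon$ and $\mathfrak m_Y\big(B(p_Y,R-\varepsilon)\setminus\psi(\tilde X)^\varepsilon\big)\le\varepsilon$. Weak pointed measured Gromov--Hausdorff (wpmGH) convergence of $(X_i,d_i,\mathfrak m_i,p_i)$ to $(X_\infty,d_\infty,\mathfrak m_\infty,p_\infty)$: there are $R_i\nearrow+\infty$, $\varepsilon_i\searrow0$ and weak $(R_i,\varepsilon_i)$-approximations $\psi_i$ from $X_i$ to $X_\infty$ with $\int_{B(p_i,R_i)}\varphi\circ\psi_i\,d\mathfrak m_i\to\int\varphi\,d\mathfrak m_\infty$ for all bounded continuous $\varphi\colon X_\infty\to\mathbb R$ with bounded support. For $p\in{\rm spt}(\mathfrak m)$, ${\rm Tan}(X,d,\mathfrak m,p)$ is the family of all pointed Polish metric measure spaces $(Y,d_Y,\mathfrak m_Y,q)$ (with $\mathfrak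 m_Y$ boundedly finite) such that $q\in{\rm spt}(\mathfrak m_Y)$ and $(X,d/s_i,\mathfrak m^p_{s_i},p)\to(Y,d_Y,\mathfrak m_Y,q)$ in the wpmGH sense for some sequence $s_i\searrow0$, where $\mathfrak m^p_{s}:=\mathfrak m/\mathfrak m(B_d(p,s))$. *)

(* Defs.v *)
From HB Require Import structures.
From mathcomp Require Import all_boot all_order all_algebra.
From mathcomp Require Import all_classical all_reals all_analysis.

Set Implicit Arguments.
Unset Strict Implicit.
Unset Printing Implicit Defensive.

Import Order.TTheory GRing.Theory Num.Theory.
Import numFieldNormedType.Exports.

Local Open Scope classical_set_scope.
Local Open Scope ring_scope.

HB.mixin Record Topological_isSeparable T & Topological T := {
  separable_space : exists2 D : set T, countable D & dense D
}.

(* [completeType] and [measurableType] are built on pointed types, hence these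
   spaces are nonempty.  The default element [point] of the carrier plays no
   role below: base points of pointed spaces are separate data. *)
#[short(type="polishMetricType")]
HB.structure Definition PolishMetric (R : numDomainType) :=
  {T of Complete T & Metric R T & Topological_isSeparable T}.

Notation borel T := (g_sigma_algebraType (@open T)).

(* [scaled c X] is [X] with the metric [d / c]; its uniformity, and therefore
   its topology and its Borel sets, are literally those of [X]. *)
Definition scaled (R : realType) (c : {posnum R}) (X : Type) : Type := X.

Section scaled_metric.
Variables (R : realType) (c : {posnum R}) (X : polishMetricType R).

HB.instance Definition _ := Complete.copy (scaled c X) X.

Let d (x y : scaled c X) : R := @mdist R X x y / c%:num.
Let b (x : scaled c X) (e : R) : set (scaled c X) := [set y | d x y < e].

Let bE x e : b x e = @ball R X x (e * c%:num).
Proof.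
by rewrite ballEmdist; apply/seteqP; split=> y; rewrite /b /d /= ltr_pdivrMr.
Qed.

Let b_center x (e : R) : 0 < e -> b x e x.
Proof. by move=> e0; rewrite bE; apply: ballxx; rewrite mulr_gt0. Qed.

Let b_sym x y (e : R) : b x e y -> b y e x.
Proof. by rewrite !bE; exact: ball_sym. Qed.

Let b_triangle x y z e1 e2 : b x e1 y -> b y e2 z -> b x (e1 + e2) z.
Proof. by rewrite !bE mulrDl; exact: ball_triangle. Qed.

Let b_entourage : @entourage (scaled c X) = entourage_ b.
Proof.
rewrite -[LHS]/(@entourage X) -entourage_ballE.
apply/seteqP; split=> A [e /= e0 eA].
  exists (e / c%:num); first by rewrite /= divr_gt0.
  by move=> xy /=; rewrite bE divfK ?gt_eqF//; exact: eA.
exists (e * c%:num); first by rewrite /= mulr_gt0.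
by move=> xy /=; rewrite -bE; exact: eA.
Qed.

HB.instance Definition _ := @Uniform_isPseudoMetric.Build R (scaled c X)
  b b_center b_sym b_triangle b_entourage.

Let d_ge0 x y : 0 <= d x y.
Proof. by rewrite /d divr_ge0// mdist_ge0. Qed.

Let d_positivity x y : d x y = 0 -> x = y.
Proof.
move=> /eqP; rewrite /d mulf_eq0 invr_eq0 (gt_eqF (gt0 c)) orbF => /eqP.
exact: mdist_positivity.
Qed.

Let ballEd x e : ball x e = [set y | d x y < e].
Proof. by []. Qed.

HB.instance Definition _ := @PseudoMetric_isMetric.Build R (scaled c X)
  d d_ge0 d_positivity ballEd.

HB.instance Definition _ :=
  @Topological_isSeparable.Build (scaled c X) (@separable_space R X).

End scaled_metric.

Record pmms (R : realType) := PMMS {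
  carrier :> polishMetricType R ;
  pmeas : {measure set (borel carrier) -> \bar R} ;
  basept : carrier
}.
Arguments PMMS {R}.
Arguments pmeas {R}.
Arguments basept {R}.

Section metric_measure.
Context {R : realType}.
Implicit Type X : polishMetricType R.

(* The library's [closed_ball] is the closure of the open ball, which may be
   strictly smaller. *)
Definition cball X (x : X) (r : R) : set X := [set y | mdist x y <= r].

Definition thickening X (A : set X) (r : R) : set X :=
  [set x | (ereal_inf [set (mdist x a)%:E | a in A] < r%:E)%E].

Definition bounded_subset X (A : set X) : Prop :=
  exists (x : X) (r : R), A `<=` ball x r.

Definition boundedly_finite X (m : {measure set (borel X) -> \bar R}) : Prop :=
  forall (x : X) (r : R), (m (ball x r) < +oo)%E.

Definition spt X (m : {measure set (borel X) -> \bar R}) : set X :=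
  [set x | forall r : R, 0 < r -> (0 < m (ball x r))%E].

Definition pointwise_doubling X (m : {measure set (borel X) -> \bar R}) : Prop :=
  {ae m, forall x : X,
    (limf_esup (fun r : R => m (ball x (2 * r)%R) / m (ball x r)) 0^'+
      < +oo)%E}.

Lemma inv_mball_ge0 X (m : {measure set (borel X) -> \bar R}) (p : X) (s : R) :
  0 <= (fine (m (ball p s)))^-1.
Proof. by rewrite invr_ge0 fine_ge0. Qed.

(* $(X, d/s, \mathfrak m / \mathfrak m(B_d(p,s)), p)$; meaningful when
   $0 < \mathfrak m(B_d(p,s)) < +\infty$. *)
Definition blowup X (m : {measure set (borel X) -> \bar R}) (p : X)
    (s : {posnum R}) : pmms R :=
  PMMS (scaled s X) (mscale (NngNum (inv_mball_ge0 m p s%:num)) m) p.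

Definition asymp_totally_bounded (omega : set_system nat)
    (X : nat -> pmms R) : Prop :=
  (forall rho : R, 0 < rho -> exists eta : R,
     omega [set i | (pmeas (X i) (ball (basept (X i)) rho) <= eta%:E)%E]) /\
  (forall rho r eps : R, 0 < rho -> 0 < r -> 0 < eps ->
     exists (M : nat) (x : forall i, 'I_M -> X i),
       (lim ((fun i => pmeas (X i)
               (cball (basept (X i)) rho `\` \bigcup_n ball (x i n) r))
             @ omega) <= eps%:E)%E).

(* A map defined on the ball only is represented by a total function whose
   values outside the ball are irrelevant. *)
Definition weak_approximation (rho eps : R) (X Y : pmms R) (psi : X -> Y) :
    Prop :=
  [/\ 0 < eps < rho,
      measurable_fun (ball (basept X) rho : set (borel X))
        (psi : borel X -> borel Y),
      psi (basept X) = basept Y &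
      exists A : set X,
        [/\ measurable (A : set (borel X)), A `<=` ball (basept X) rho,
            A (basept X),
            (forall x y, A x -> A y ->
               `|mdist x y - mdist (psi x) (psi y)| <= eps) &
            (pmeas X (ball (basept X) rho `\` A) <= eps%:E)%E /\
            (pmeas Y (ball (basept Y) (rho - eps) `\`
                      thickening (psi @` A) eps) <= eps%:E)%E]].

Definition wpmGH_cvg (X : nat -> pmms R) (Y : pmms R) : Prop :=
  exists (rho eps : nat -> R) (psi : forall i, X i -> Y),
    [/\ nondecreasing_seq rho /\ rho @ \oo --> +oo,
        nonincreasing_seq eps /\ eps @ \oo --> 0,
        forall i, weak_approximation (rho i) (eps i) (psi i) &
        forall phi : Y -> R, continuous phi ->
          (exists C : R, forall y, `|phi y| <= C) ->
          bounded_subset (closure [set y | phi y != 0]) ->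
          (\int[pmeas (X i)]_(x in ball (basept (X i)) (rho i))
             (phi (psi i x))%:E)%E @[i --> \oo]
          --> (\int[pmeas Y]_y (phi y)%:E)%E].

Definition Tan X (m : {measure set (borel X) -> \bar R}) (p : X) :
    set (pmms R) :=
  [set Y | [/\ boundedly_finite (pmeas Y), spt (pmeas Y) (basept Y) &
    exists s : nat -> {posnum R},
      [/\ nonincreasing_seq (fun i => (s i)%:num),
          (s i)%:num @[i --> \oo] --> 0 &
          wpmGH_cvg (fun i => blowup m p (s i)) Y]]].

End metric_measure.

(* Main.v *)
Require Import Defs.
From HB Require Import structures.
From mathcomp Require Import all_boot all_order all_algebra.
From mathcomp Require Import all_classical all_reals all_analysis.
From mathcomp Require Import measurable_realfun lra.

(** The sets A_k of points x with m(B(x,2r)) <= k m(B(x,r)) for all r < 1/k are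
closed and cover almost all of X.  The Vitali covering argument, which only uses
doubling at the centers of the balls, shows that almost every point of A_k is a
density point of A_k.  At such a point p the blow-ups of A_k are uniformly
totally bounded by a volume count, and they carry asymptotically all the mass
of bounded balls.

A tangent is built along the ultrafilter.  The distances between the points of
finite nets of A_k in the blow-ups have ultralimits, and Y is the completion of
the resulting pseudometric on the set of labels.  A point x of a blow-up has a
code: the integer part of its distance to p, followed by the label of a net
point close to x at each scale 1/(n+1).  The ultralimits of the masses of the
code cells are the weights of a tree, which is realized by a nested family of
intervals of the real line; the measure of Y is the image of the Lebesgue
measure under the map sending a code to the limit of its net points.  Sending x
to its net point at scale 1/(n+1) then gives the weak approximations, and the
integrals of test functions are finite sums over code cells up to dominated
convergence. *)

Set Implicit Arguments.
Unset Strict Implicit.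
Unset Printing Implicit Defensive.

Import Order.TTheory GRing.Theory Num.Theory.
Import numFieldNormedType.Exports.

Local Open Scope classical_set_scope.
Local Open Scope ring_scope.

(** * Balls and the Vitali covering lemma *)

(** The limsup condition gives neither a constant nor a scale uniform in the point, and fixing k
    makes both uniform only at the points of A_k. Every use of doubling is therefore at a ball
    centred in A_k, and outside A_k nothing is known except that the mass is relatively small near a
    density point. The nets cover A_k only; this fits conclusions that allow exceptional sets of
    small mass.

    The blow-ups have no common ambient space. What they share is the countable set of labels and
    the tree of codes, so all limits are taken of numbers indexed by these. An ultralimit of masses
    is a priori only finitely additive; countable additivity is inherited from Lebesgue measure once
    the weights are lengths of nested intervals. Codes start with the distance to p so that every
    nonempty prefix confines its cell to a bounded ball; the root of the tree may have infinite
    mass.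

    An approximation at level n needs finitely many conditions on the index. They hold on an element
    of the ultrafilter, which is infinite, so an increasing sequence of indices can be extracted. *)

Section metric_balls.
Context {R : realType} {X : polishMetricType R}.
Implicit Types (x y p q : X) (r s : R) (A : set X).

Lemma in_ball x r y : ball x r y <-> mdist x y < r.
Proof. by rewrite ballEmdist. Qed.

Lemma sub_ball x y r s : mdist x y + s <= r -> ball y s `<=` ball x r.
Proof.
move=> xy z; rewrite !in_ball => yz.
by have := metric_triangle x y z; lra.
Qed.

Lemma sub_ball_radius x r s : s <= r -> ball x s `<=` ball x r.
Proof. by move=> sr; apply: sub_ball; rewrite mdistxx add0r. Qed.

Lemma metric_ball_open x r : open (ball x r).
Proof.
rewrite openE => y; rewrite in_ball => xy.
apply/nbhs_ballP; exists (r - mdist x y) => /=; first by rewrite subr_gt0.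
by apply: sub_ball; rewrite subrKC.
Qed.

Lemma open_borel A : open A -> measurable (A : set (borel X)).
Proof. exact: sub_sigma_algebra. Qed.

Lemma closed_borel A : closed A -> measurable (A : set (borel X)).
Proof.
move=> cA; rewrite -[A]setCK; apply: (@measurableC _ (borel X)).
by apply: open_borel; exact: closed_openC.
Qed.

Lemma ball_borel x r : measurable (ball x r : set (borel X)).
Proof. by apply: open_borel; exact: metric_ball_open. Qed.

Lemma open_ballP A : open A <-> forall x, A x -> exists2 e, 0 < e & ball x e `<=` A.
Proof.
rewrite openE; split=> oA x Ax.
  by have /nbhs_ballP[e] := oA _ Ax; exists e.
by apply/nbhs_ballP; have [e e0 eA] := oA _ Ax; exists e.
Qed.

Lemma dense_approx (Q : set X) : dense Q ->
  forall x e, 0 < e -> exists2 q, Q q & mdist x q < e.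
Proof.
move=> dQ x e e0; have [|q [xq Qq]] := dQ (ball x e) _ (metric_ball_open x e).
  by exists x; rewrite in_ball mdistxx.
by exists q => //; rewrite -in_ball.
Qed.

End metric_balls.

(* A maximal disjoint subfamily could consist of tiny balls.  Zorn's lemma is
   therefore applied to the disjoint subfamilies J such that any ball meeting J
   meets a ball of J of at least half its radius. *)
Lemma vitali_covering {R : realType} {X : polishMetricType R} (E : set X)
    (rho : X -> R) (M : R) :
  (forall x, E x -> 0 < rho x <= M) ->
  exists J : set X, [/\ J `<=` E,
    forall a b, J a -> J b -> ball a (rho a) `&` ball b (rho b) !=set0 -> a = b &
    forall b, E b -> exists2 a, J a & mdist a b < 3 * rho a].
Proof.
move=> Erho; pose meets a b := ball a (rho a) `&` ball b (rho b) !=set0.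
have meetsC a b : meets a b -> meets b a by rewrite /meets setIC.
have meetsxx a : E a -> meets a a.
  by move=> /Erho/andP[a0 _]; exists a; rewrite setIid in_ball mdistxx.
pose P (J : set X) := [/\ J `<=` E,
  forall a b, J a -> J b -> meets a b -> a = b &
  forall b, E b -> (exists2 a, J a & meets a b) ->
    exists a, [/\ J a, meets a b & rho b <= 2 * rho a]].
have [|J [[JE Jdisj Jbig] Jmax]] := @Zorn_bigcup X P.
  move=> F FP Ftot; split.
  - by move=> a [J FJ Ja]; have [/(_ _ Ja)] := FP _ FJ.
  - move=> a b [J FJ Ja] [K FK Kb].
    have [/(_ _ Ja) Ka|/(_ _ Kb) Jb] := Ftot _ _ FJ FK.
      by have [_ /(_ a b Ka Kb)] := FP _ FK.
    by have [_ /(_ a b Ja Jb)] := FP _ FJ.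
  - move=> b Eb [a [J FJ Ja] ab].
    have [_ _ /(_ _ Eb)[|c [Jc cb bc]]] := FP _ FJ; first by exists a.
    by exists c; split=> //; exists J.
exists J; split=> // b Eb.
have [[a Ja ab]|bfree] := pselect (exists2 a, J a & meets a b).
  (* The two balls meet and rho b <= 2 rho c, so their centres are less than rho c + rho b <= 3 rho
     c apart. *)
  have [c [Jc [x [cx bx]] bc]] := Jbig _ Eb (ex_intro2 _ _ a Ja ab).
  exists c => //; move: cx bx; rewrite !in_ball => cx bx.
  by have := metric_triangle c x b; rewrite (metric_sym x b); lra.
exfalso; pose free := [set b | E b /\ ~ exists2 a, J a & meets a b].
have hs : has_sup (rho @` free).
  split; first by exists (rho b), b.
  by exists M => _ [a [/Erho/andP[_ ?] _] <-].
have b0 : 0 < rho b by have /andP[] := Erho _ Eb.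
have s0 : 0 < sup (rho @` free).
  by apply: (lt_le_trans b0); apply: sup_upper_bound => //; exists b.
have s20 : 0 < sup (rho @` free) / 2 by rewrite divr_gt0.
(* A free ball with more than half the supremum of the free radii can be added to [J]: any other
   free ball that meets it has at most twice its radius. This contradicts maximality. *)
have [_ [c [Ec cfree] <-] cbig] := sup_adherent s20 hs.
apply: (Jmax (J `|` [set c])).
  split; first by move=> a Ja; left.
  by move=> /(_ c (or_intror erefl)) Jc; apply: cfree; exists c => //; exact: meetsxx.
split.
- by move=> a [/JE//|->].
- move=> a d [Ja|->] [Jd|->] //; first exact: Jdisj.
  + by move=> ac; case: cfree; exists a.
  + by move=> /meetsC dc; case: cfree; exists d.
- move=> d Ed [a aJ ad].
  have [dJ|dfree] := pselect (exists2 a, J a & meets a d).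
    by have [e [Je ed de]] := Jbig _ Ed dJ; exists e; split=> //; left.
  have ac : a = c by case: aJ => // Ja; case: dfree; exists a.
  exists c; split; [by right|by rewrite -ac|].
  have := sup_upper_bound hs (ex_intro2 _ _ d (conj Ed dfree) erefl).
  by move: cbig; lra.
Qed.

(** Each ball contains a point of a countable dense set, and disjoint balls contain different ones.
    The numbering turns unions over [J] into countable unions. *)
Lemma countable_disjoint_balls {R : realType} {X : polishMetricType R}
    (J : set X) (rho : X -> R) :
  (forall a, J a -> 0 < rho a) ->
  (forall a b, J a -> J b -> ball a (rho a) `&` ball b (rho b) !=set0 -> a = b) ->
  exists g : X -> nat, {in J &, injective g}.
Proof.
move=> rho0 disj; have [Q /countable_injP[g gQ] dQ] := @separable_space R X.
have : forall a, exists q, J a -> Q q /\ ball a (rho a) q.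
  move=> a; have [Ja|nJa] := pselect (J a); last by exists a.
  have [q Qq aq] := dense_approx dQ a (rho0 _ Ja).
  by exists q => _; rewrite in_ball.
move=> /choice[q qP]; exists (g \o q) => a b; rewrite !inE => Ja Jb /= qab.
have [Qa aq] := qP _ Ja; have [Qb bq] := qP _ Jb.
apply: disj => //; exists (q a); split=> //.
by rewrite (gQ (q a) (q b)) ?inE.
Qed.

(** * Doubling sets and density points *)

Section doubling_sets.
Context {R : realType} {X : polishMetricType R}.
Variable m : {measure set (borel X) -> \bar R}.
Hypothesis m_finite : boundedly_finite m.
Implicit Types (x y p q : X) (r s : R).

Lemma le_mball (A B : set X) : measurable (A : set (borel X)) ->
  measurable (B : set (borel X)) -> A `<=` B -> (m A <= m B)%E.
Proof. by move=> mA mB AB; apply: le_measure => //; rewrite inE. Qed.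

Lemma mball_fin x r (A : set X) : measurable (A : set (borel X)) ->
  A `<=` ball x r -> m A \is a fin_num.
Proof.
move=> mA Ax; rewrite ge0_fin_numE//.
by rewrite (le_lt_trans _ (m_finite x r))// le_mball//; exact: ball_borel.
Qed.

(** Continuity from below along the radii r - 1/(n+1). It lets inequalities between masses of open
    balls pass to a limit of centres. *)
Lemma mball_le_left x r (c : \bar R) :
  (forall s, 0 < s -> (m (ball x (r - s)) <= c)%E) -> (m (ball x r) <= c)%E.
Proof.
move=> mc; pose F n : set (borel X) := ball x (r - n.+1%:R^-1).
have mF n : measurable (F n) by exact: ball_borel.
have FE : \bigcup_n F n = (ball x r : set X).
  apply/seteqP; split=> [y [n _]|y].
    by apply: sub_ball_radius; rewrite gerBl invr_ge0.
  move=> /in_ball xy.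
  have [n _ /(_ n (leqnn n)) nxy] := near_infty_natSinv_lt (PosNum (etrans (subr_gt0 _ _) xy)).
  exists n => //; apply/in_ball; move: (n.+1%:R^-1) nxy => /= e; lra.
have := @nondecreasing_cvg_mu _ (borel X) R m F mF.
rewrite FE => /(_ (ball_borel _ _)) mcvg.
have mcvg' : (m \o F) n @[n --> \oo] --> m (ball x r).
  apply: mcvg => a b ab; apply/subsetPset/sub_ball_radius.
  by rewrite lerD2l lerN2 lef_pV2 ?posrE// ler_nat.
rewrite -(cvg_lim _ mcvg')//; apply: lime_le; first by apply/cvg_ex; eexists; exact: mcvg'.
by apply: nearW => n; apply: mc; rewrite invr_gt0.
Qed.

(** A point outside the support lies in a null ball whose centre is in the countable dense set and
    whose radius is some 1/(k+1); there are countably many such balls. *)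
Lemma ae_spt : {ae m, forall x, spt m x}.
Proof.
have [Q /countable_injP[g gQ] dQ] := @separable_space R X.
pose G n : set (borel X) :=
  \bigcup_(k in [set: nat]) \bigcup_(q in [set q | [/\ Q q, g q = n & m (ball q k.+1%:R^-1) = 0%E]])
     ball q k.+1%:R^-1.
have : m.-negligible (\bigcup_n G n).
  apply: negligible_bigcup => n; apply: negligible_bigcup => k.
  have [[q [Qq qn mq0]]|noq] :=
      pselect (exists q, [/\ Q q, g q = n & m (ball q k.+1%:R^-1) = 0%E]).
    exists (ball q k.+1%:R^-1); split=> //; first exact: ball_borel.
    move=> x [q' [Qq' q'n _]]; suff -> : q' = q by [].
    by apply: gQ; rewrite ?inE// q'n.
  exists set0; split=> // x [q qP _]; case: noq; by exists q.
apply: negligibleS => x /= /existsNP[r /not_implyP[r0]] /negP.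
rewrite -leNgt measure_le0 => /eqP xr0.
have r20 : 0 < r / 2 by rewrite divr_gt0.
have [k _ /(_ k (leqnn k)) /= kr] := near_infty_natSinv_lt (PosNum r20).
have k0 : 0 < k.+1%:R^-1 :> R by rewrite invr_gt0.
have [q Qq xq] := dense_approx dQ x k0.
exists (g q) => //; exists k => //; exists q; last by rewrite in_ball metric_sym.
split=> //; apply/eqP; rewrite -measure_le0 -xr0; apply: le_mball; [exact: ball_borel..|].
by apply: sub_ball; move: (k.+1%:R^-1) kr xq => e; lra.
Qed.

Lemma ae_conseq (P Q S : X -> Prop) : (forall x, P x -> Q x -> S x) ->
  {ae m, forall x, P x} -> {ae m, forall x, Q x} -> {ae m, forall x, S x}.
Proof.
move=> PQS mP mQ; have := negligibleU mP mQ; apply: negligibleS => x /= nSx.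
have [Px|] := pselect (P x); [right => Qx|by left].
by apply: nSx; exact: PQS.
Qed.

Definition doubling_set (C delta : R) : set X := [set x | forall r,
  0 < r < delta -> (m (ball x (2 * r)) <= C%:E * m (ball x r))%E].

Lemma closed_doubling_set C delta : 0 <= C -> closed (doubling_set C delta).
Proof.
move=> C0 x xcl r /andP[r0 rdelta]; apply: mball_le_left => s s0.
(* For y within e of x, the ball about x of radius 2r - s lies in the ball about y of radius 2(r -
   e) as soon as 3e <= s, and e <= r/2 keeps r - e positive. *)
pose e := Num.min (s / 3) (r / 2).
have e0 : 0 < e by rewrite lt_min !divr_gt0.
have es : e <= s / 3 by rewrite ge_min lexx.
have er : e <= r / 2 by rewrite ge_min lexx orbT.
have [y [/(_ (r - e)) dy]] := xcl (ball x e) (nbhsx_ballx _ _ e0).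
rewrite in_ball => xy.
apply: (@le_trans _ _ (m (ball y (2 * (r - e))))).
  apply: le_mball; [exact: ball_borel..|].
  by apply: sub_ball; rewrite metric_sym; lra.
apply: (le_trans (dy _)); first by lra.
rewrite lee_wpmul2l ?lee_fin// le_mball//; try exact: ball_borel.
by apply: sub_ball; lra.
Qed.

(** A finite limsup bounds the quotients at all small radii; an integer above both this bound and
    the inverse of the radius threshold serves as k. On the support the denominators are positive,
    so the quotient can be multiplied out. *)
Lemma ae_doubling_set : pointwise_doubling m ->
  {ae m, forall x, exists k : nat, doubling_set k.+1%:R k.+1%:R^-1 x}.
Proof.
move=> dm; apply: ae_conseq dm ae_spt => x dx sx.
have [_ [V [d /= d0 Vd] <-] Vlt] := ereal_inf_lt dx.
set s := ereal_sup _ in Vlt.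
have [c s0] : exists c : R, (s <= c%:E)%E.
  case: s Vlt => [c| |] // _; first by exists c.
  by exists 0; rewrite leNye.
have [k ck] : exists k : nat, Num.max c d^-1 < k.+1%:R.
  exists (Num.bound `|Num.max c d^-1|).
  apply: (le_lt_trans (ler_norm _)).
  apply: (lt_le_trans (archi_boundP (normr_ge0 _))).
  by rewrite ler_nat.
move: ck; rewrite gt_max => /andP[ck dk].
exists k => r /andP[r0 rk].
have rd : r < d by rewrite (lt_trans rk)// -[ltRHS]invrK ltf_pV2 ?posrE// invr_gt0.
have mr0 := sx _ r0; have mrfin := mball_fin (ball_borel x r) (@subset_refl _ _).
have rat : (m (ball x (2 * r)) / m (ball x r) <= c%:E)%E.
  apply: le_trans s0; apply: ereal_sup_ubound; exists r => //.
  by apply: Vd => //=; rewrite sub0r normrN gtr0_norm.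
have mr0' : 0 < fine (m (ball x r)) by rewrite fine_gt0// mr0 ltey_eq mrfin.
rewrite -(fineK mrfin) in rat *; rewrite inver gt_eqF// in rat.
rewrite -(@lee_pdivrMr _ _ _ _ mr0').
by apply: le_trans rat _; rewrite lee_fin ltW.
Qed.

End doubling_sets.

(** * Density points of closed doubling sets *)

Section density.
Context {R : realType} {X : polishMetricType R}.
Variable m : {measure set (borel X) -> \bar R}.
Hypothesis m_finite : boundedly_finite m.
Variables (C delta : R) (A : set X).
Hypotheses (C0 : 0 <= C) (delta0 : 0 < delta) (closedA : closed A).
Hypothesis A_doubling : A `<=` doubling_set m C delta.
Implicit Types (x y p q : X) (r s t : R).

Definition density_point (p : X) : Prop := forall t, 0 < t ->
  exists2 d, 0 < d & forall r, 0 < r < d ->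
    (m (ball p r `\` A) <= t%:E * m (ball p r))%E.

Let thin t : set X := [set p | A p /\ ~ exists2 d, 0 < d & forall r, 0 < r < d ->
    (m (ball p r `\` A) <= t%:E * m (ball p r))%E].

(** Open neighbourhoods of [A], cut down to a ball to have finite mass. As [A] is closed, the mass
    of their part outside [A] tends to 0 as j grows. *)
Let near_A (x0 : X) (n j : nat) : set X :=
  [set x | exists2 a, A a & mdist a x < j.+1%:R^-1] `&` ball x0 n%:R.

Let borelA : measurable (A : set (borel X)). Proof. exact: closed_borel. Qed.

Let near_A_borel x0 n j : measurable (near_A x0 n j : set (borel X)).
Proof.
apply: (@measurableI _ (borel X)); last exact: ball_borel.
apply: open_borel.
suff -> : [set x | exists2 a, A a & mdist a x < j.+1%:R^-1] =
    \bigcup_(a in A) ball a j.+1%:R^-1.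
  by apply: bigcup_open => a _; exact: metric_ball_open.
by apply/seteqP; split=> x [a Aa]; [|move=> /in_ball]; exists a => //; apply/in_ball.
Qed.

(** Choose disjoint Vitali balls centred at thin points, each with at least the fraction t of its
    mass outside [A]. Enlarging them costs a factor C^2 by doubling at their centres, and their
    parts outside [A] are disjoint subsets of a thin neighbourhood of [A]. *)
Let thin_cover t x0 n j : 0 < t -> exists V : set X,
  [/\ measurable (V : set (borel X)), thin t `&` ball x0 n%:R `<=` V &
    (m V <= (C ^+ 2 / t)%:E * m (near_A x0 n.+1 j `\` A))%E].
Proof.
move=> t0; set E := thin t `&` _.
have j0 : 0 < j.+1%:R^-1 :> R by rewrite invr_gt0.
have j1 : j.+1%:R^-1 <= 1 :> R by rewrite invf_le1// ler1n.
(* Radii below delta/2 allow two successive doublings; radii below 1/(j+1) keep the balls inside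
   [near_A x0 n.+1 j]. *)
pose M := Num.min (delta / 2) j.+1%:R^-1.
have M0 : 0 < M by rewrite lt_min divr_gt0.
have : forall p, exists r, E p -> 0 < r < M /\
    (t%:E * m (ball p r) <= m (ball p r `\` A))%E.
  move=> p; have [[[Ap thinp] _]|nEp] := pselect (E p); last by exists 0.
  apply: contrapT => /forallNP nr; apply: thinp; exists M => // r rM.
  have /not_implyP[_ /not_andP[//|/negP]] := nr r.
  by rewrite -ltNge => /ltW.
move=> /choice[rho rhoP].
have rho0 p : E p -> 0 < rho p <= M.
  by move=> /rhoP[/andP[-> /ltW ->]].
have [J [JE Jdisj Jcov]] := vitali_covering rho0.
have [|g gJ] := @countable_disjoint_balls R X J rho _ Jdisj.
  by move=> a /JE/rho0/andP[].
(* At most one centre has number k, so [G k] is a single ball or empty. The covering needs the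
   factor 3; [G'] takes 4, which is two doublings. *)
pose G k : set (borel X) := \bigcup_(a in J `&` g @^-1` [set k]) ball a (rho a).
pose G' k : set (borel X) := \bigcup_(a in J `&` g @^-1` [set k]) ball a (4 * rho a).
have mG k : measurable (G k).
  by apply: open_borel; apply: bigcup_open => a _; exact: metric_ball_open.
have mG' k : measurable (G' k).
  by apply: open_borel; apply: bigcup_open => a _; exact: metric_ball_open.
have mGA k : measurable (G k `\` A) by exact: measurableD.
have GA_triv : trivIset setT (fun k => G k `\` A).
  apply/trivIsetP => k l _ _ kl; rewrite -subset0 => x [[[a [Ja ak] ax] _] [[b [Jb bl] bx] _]].
  have ab : a = b by apply: Jdisj => //; exists x.
  by move: kl; rewrite -ak -bl ab eqxx.
exists (\bigcup_k G' k); split.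
- exact: bigcupT_measurable.
- move=> b /Jcov[a Ja ab]; exists (g a) => //; exists a => //.
  have /andP[r0 _] := rho0 _ (JE _ Ja).
  by apply/in_ball; rewrite (lt_le_trans ab)// ler_pM2r// ler_nat.
have G'G k : (m (G' k) <= (C ^+ 2 / t)%:E * m (G k `\` A))%E.
  have [[a [Ja ak]]|noa] := pselect (exists a, J a /\ g a = k); last first.
    have -> : G' k = set0.
      by rewrite -subset0 => x [a [Ja ak] _]; case: noa; exists a.
    by rewrite measure0 mule_ge0// lee_fin divr_ge0 ?sqr_ge0// ltW.
  have aE b : J b -> g b = k -> b = a.
    by move=> Jb bk; apply: gJ; rewrite ?inE// bk.
  have -> : G' k = ball a (4 * rho a).
    apply/seteqP; split=> x; last by exists a.
    by move=> [b [Jb bk]]; rewrite (aE b).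
  have -> : G k = ball a (rho a).
    apply/seteqP; split=> x; last by exists a.
    by move=> [b [Jb bk]]; rewrite (aE b).
  have [/andP[r0]] := rhoP _ (JE _ Ja).
  rewrite lt_min => /andP[rdelta _] big.
  have [[Aa _] _] := JE _ Ja.
  have -> : (4 * rho a) = 2 * (2 * rho a) by lra.
  apply: (le_trans (A_doubling Aa _)); first by lra.
  rewrite expr2 -mulrA EFinM -muleA lee_wpmul2l ?lee_fin//.
  apply: (le_trans (A_doubling Aa _)); first by lra.
  rewrite EFinM -muleA lee_wpmul2l ?lee_fin//.
  rewrite -[leLHS]mul1e -(mulVf (lt0r_neq0 t0)) EFinM -muleA.
  by rewrite lee_wpmul2l// lee_fin invr_ge0 ltW.
apply: (@le_trans _ _ (\sum_(0 <= k <oo) m (G' k)))%E.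
  by apply: measure_sigma_subadditive => //; exact: bigcupT_measurable.
apply: (@le_trans _ _ (\sum_(0 <= k <oo) ((C ^+ 2 / t)%:E * m (G k `\` A))))%E.
  by apply: lee_nneseries.
rewrite nneseriesZl//; apply: lee_wpmul2l.
  by rewrite lee_fin divr_ge0 ?sqr_ge0// ltW.
rewrite -measure_semi_bigcup//; last exact: bigcupT_measurable.
apply: le_mball; first exact: bigcupT_measurable.
  by apply: (@measurableD _ (borel X)) => //; exact: near_A_borel.
move=> x [k _ [[a [Ja _] ax] nAx]]; split=> //.
have [[Aa _] ax0] := JE _ Ja; have [/andP[r0]] := rhoP _ (JE _ Ja).
rewrite lt_min => /andP[_ rj] _; move: ax ax0 => /in_ball ax /in_ball ax0; split.
  by exists a => //; rewrite (lt_trans ax).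
apply/in_ball; rewrite -natr1; have := metric_triangle x0 a x.
by move: (j.+1%:R^-1) j1 rj => e; lra.
Qed.

(** The covers at the scales 1/(j+1) have masses tending to 0, so their intersection over j is null.
    Working inside one ball at a time makes the masses finite. *)
Let thin_negligible t : 0 < t -> m.-negligible (thin t).
Proof.
move=> t0; have : m.-negligible (\bigcup_n (thin t `&` ball (point : X) n%:R)).
  apply: negligible_bigcup => n.
  have := fun j => @thin_cover t point n j t0; move=> /choice[V VP].
  have mV : measurable (\bigcap_j V j : set (borel X)).
    by apply: (@bigcapT_measurable _ (borel X)) => j; have [] := VP j.
  exists (\bigcap_j V j); split=> //; last first.
    by move=> x Ex j _; have [_ /(_ _ Ex)] := VP j.
  pose F j : set (borel X) := near_A point n.+1 j `\` A.
  have mF j : measurable (F j).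
    by apply: (@measurableD _ (borel X)) => //; exact: near_A_borel.
  have F0 : \bigcap_j F j = set0.
    rewrite -subset0 => x Fx; have [_ nAx] := Fx 0%N I; apply: nAx.
    apply: closedA => B /nbhs_ballP[e /= e0 eB].
    have [j _ /(_ j (leqnn j)) /= je] := near_infty_natSinv_lt (PosNum e0).
    have [[[a Aa ax] _] _] := Fx j I.
    by exists a; split=> //; apply: eB; apply/in_ball; rewrite metric_sym (lt_trans ax).
  have Fcvg : m (F j) @[j --> \oo] --> 0%E.
    rewrite -(measure0 m) -F0; apply: nonincreasing_cvg_mu => //.
    - rewrite ltey_eq (@mball_fin _ _ _ m_finite point n.+1%:R)//.
      by move=> x [[]].
    - by rewrite F0.
    - move=> a b ab; apply/subsetPset => x [[[c Ac cx] xb] nAx]; split=> //; split=> //.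
      exists c => //; apply: (lt_le_trans cx).
      by rewrite lef_pV2 ?posrE// ler_nat.
  have KFcvg : ((C ^+ 2 / t)%:E * m (F j))%E @[j --> \oo] --> 0%E.
    by rewrite -(mule0 (C ^+ 2 / t)%:E); apply: cvgeZl.
  apply/eqP; rewrite -measure_le0 -(cvg_lim _ KFcvg)//; apply: lime_ge.
    by apply/cvg_ex; eexists; exact: KFcvg.
  apply: nearW => j; have [mVj _] := VP j; apply: le_trans.
  by apply: le_mball => // x; exact.
apply: negligibleS => p thinp.
exists (Num.bound (mdist point p)) => //; split=> //; apply/in_ball.
by apply: archi_boundP; exact: mdist_ge0.
Qed.

Lemma ae_density : {ae m, forall p, A p -> density_point p}.
Proof.
have : m.-negligible (\bigcup_n thin n.+1%:R^-1).
  by apply: negligible_bigcup => n; apply: thin_negligible; rewrite invr_gt0.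
apply: negligibleS => p /= /not_implyP[Ap] /existsNP[t] /not_implyP[t0 nd].
have [n _ /(_ n (leqnn n)) /= nt] := near_infty_natSinv_lt (PosNum t0).
exists n => //; split=> // -[d d0 dP]; apply: nd; exists d => // r rd.
by apply: le_trans (dP _ rd) _; rewrite lee_wpmul2r// lee_fin ltW.
Qed.

End density.

(** * Volume estimates at a density point *)

Section blowup_estimates.
Context {R : realType} {X : polishMetricType R}.
Variable m : {measure set (borel X) -> \bar R}.
Hypothesis m_finite : boundedly_finite m.
Variables (C delta : R) (A : set X) (p : X).
Hypotheses (C0 : 0 <= C) (delta0 : 0 < delta).
Hypothesis A_doubling : A `<=` doubling_set m C delta.
Hypotheses (Ap : A p) (p_spt : spt m p) (p_density : density_point m A p).
Implicit Types (x y : X) (r s t : R).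

Let doubling_iter x r j : A x -> 0 < r -> 2 ^+ j * r <= delta ->
  (m (ball x (2 ^+ j * r)) <= (C ^+ j)%:E * m (ball x r))%E.
Proof.
move=> Ax r0; elim: j => [|j IH] jr; first by rewrite !expr0 mul1r mul1e.
have j0 : 0 < 2 ^+ j * r by rewrite mulr_gt0// exprn_gt0.
rewrite exprS -mulrA in jr *.
apply: (le_trans (A_doubling Ax _)); first by rewrite j0/=; lra.
by rewrite exprS EFinM -muleA lee_wpmul2l ?lee_fin// IH//; lra.
Qed.

Let exists_pow2 t : exists j : nat, t <= 2 ^+ j.
Proof.
exists (Num.bound `|t|); apply: (le_trans (ler_norm t)).
rewrite (le_trans (ltW (archi_boundP (normr_ge0 t))))//.
by rewrite -natrX ler_nat ltnW// ltn_expl.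
Qed.

Lemma ball_growth rho : exists2 K, 0 < K & exists2 d, 0 < d &
  forall s, 0 < s < d -> (m (ball p (rho * s)) <= K%:E * m (ball p s))%E.
Proof.
(* Here j doublings at [p] pass from radius s to at least rho s; the summand 1 makes the constant
   positive even when C = 0. *)
have [j rhoj] := exists_pow2 rho; exists (C ^+ j + 1).
  by rewrite ltr_wpDl// exprn_ge0.
have j0 : 0 < 2 ^+ j :> R by rewrite exprn_gt0.
exists (delta / 2 ^+ j); first by rewrite divr_gt0.
move=> s /andP[s0 sd]; apply: (@le_trans _ _ (m (ball p (2 ^+ j * s)))).
  by apply: le_mball; [exact: ball_borel..|apply: sub_ball_radius; rewrite ler_pM2r].
apply: (le_trans (doubling_iter Ap s0 _)).
  by rewrite mulrC -ler_pdivlMr// ltW.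
by rewrite lee_wpmul2r// lee_fin lerDl.
Qed.

(** This is [ball_growth] for the factor 1/rho, applied to the ball of radius rho s. *)
Lemma ball_decay rho : 0 < rho -> exists2 c, 0 < c & exists2 d, 0 < d &
  forall s, 0 < s < d -> (c%:E * m (ball p s) <= m (ball p (rho * s)))%E.
Proof.
move=> rho0; have [K K0 [d d0 Kd]] := ball_growth rho^-1.
exists K^-1; first by rewrite invr_gt0.
exists (d / rho); first by rewrite divr_gt0.
move=> s /andP[s0 sd].
have KE : (m (ball p s) <= K%:E * m (ball p (rho * s)))%E.
  have := Kd (rho * s); rewrite (mulKf (lt0r_neq0 rho0)); apply.
  by rewrite mulr_gt0//= mulrC -ltr_pdivlMr.
rewrite -[leRHS]mul1e -(mulVf (lt0r_neq0 K0)) EFinM -muleA.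
by rewrite lee_wpmul2l// lee_fin invr_ge0 ltW.
Qed.

(** Density at the radius rho s with threshold e/K absorbs the growth factor K from radius s to
    radius rho s. *)
Lemma complement_decay rho e : 0 < rho -> 0 < e -> exists2 d, 0 < d &
  forall s, 0 < s < d -> (m (ball p (rho * s) `\` A) <= e%:E * m (ball p s))%E.
Proof.
move=> rho0 e0; have [K K0 [d d0 Kd]] := ball_growth rho.
have [d' d'0 dens] := p_density (divr_gt0 e0 K0).
exists (Num.min d (d' / rho)); first by rewrite lt_min d0 divr_gt0.
move=> s /andP[s0]; rewrite lt_min => /andP[sd sd'].
apply: (le_trans (dens (rho * s) _)).
  by rewrite mulr_gt0//= mulrC -ltr_pdivlMr.
rewrite EFinM -muleA; apply: lee_wpmul2l; first by rewrite lee_fin ltW.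
rewrite -[leRHS]mul1e -(mulVf (lt0r_neq0 K0)) EFinM -muleA.
apply: lee_wpmul2l; first by rewrite lee_fin invr_ge0 ltW.
by apply: Kd; rewrite s0.
Qed.

(** Greedy choice: a point not covered by the chosen ones has distance at least e from all of them
    and can be added. *)
Let separated_or_cover (S : set X) e n :
  (exists l : seq X, [/\ (size l <= n)%N, forall x, x \in l -> S x &
     forall y, S y -> exists2 x, x \in l & mdist x y < e]) \/
  (exists l : seq X, [/\ size l = n, forall x, x \in l -> S x &
     pairwise (fun x y => e <= mdist x y) l]).
Proof.
elim: n => [|n [[l [ln lS lcov]]|[l [ln lS lsep]]]].
- by right; exists [::].
- by left; exists l; split=> //; exact: leqW.
have [lcov|] := pselect (forall y, S y -> exists2 x, x \in l & mdist x y < e).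
  by left; exists l; split=> //; rewrite ln.
move=> /existsNP[y /not_implyP[Sy ly]]; right; exists (y :: l); split.
- by rewrite /= ln.
- by move=> x; rewrite inE => /orP[/eqP->|/lS].
- rewrite /= lsep andbT; apply/allP => x xl; rewrite leNgt; apply/negP => yx.
  by apply: ly; exists x => //; rewrite metric_sym.
Qed.

(** Packing: the balls of radius e/2 about e-separated points are disjoint, so their masses add
    up. *)
Let separated_measure (l : seq X) e (V : \bar R) (K : R) : 0 <= K ->
  pairwise (fun x y => e <= mdist x y) l ->
  (forall x, x \in l -> (V <= K%:E * m (ball x (e / 2)))%E) -> (0 <= V)%E ->
  ((size l)%:R%:E * V <= K%:E * m (\big[setU/set0]_(x <- l) ball x (e / 2)))%E.
Proof.
move=> K0 + + V0; elim: l => [|x l IH] /=; first by rewrite big_nil measure0 mul0e mule0.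
move=> /andP[xl lsep] lV; rewrite big_cons measureU.
- rewrite -natr1 EFinD ge0_muleDl ?lee_fin// mul1e addeC ge0_muleDr//.
  by apply: leeD; [apply: lV; rewrite mem_head|apply: IH => // y yl; apply: lV; rewrite inE yl orbT].
- exact: ball_borel.
- by apply: bigsetU_measurable => y _; exact: ball_borel.
- rewrite -subset0 => y [/in_ball xy]; rewrite -bigcup_seq => -[z /= zl /in_ball zy].
  have /allP/(_ _ zl) := xl; apply/negP; rewrite -ltNge.
  by have := metric_triangle x y z; rewrite (metric_sym y z); lra.
Qed.

(** More than C^j separated points of [A] would be too many: each half-radius ball carries at least
    the fraction C^-j of the mass V of a ball containing all of them. The bound does not depend on
    the scale s. *)
Lemma ball_nets rho r : 0 < rho -> 0 < r -> exists M : nat, exists2 d, 0 < d &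
  forall s, 0 < s < d -> exists z : nat -> X, (forall l, A (z l)) /\
    forall x, A x -> ball p (rho * s) x -> exists2 l, (l < M)%N & ball (z l) (r * s) x.
Proof.
move=> rho0 r0; have [j jP] := exists_pow2 ((2 * rho + r) / (r / 2)).
have r20 : 0 < r / 2 by rewrite divr_gt0.
rewrite ler_pdivrMr// in jP.
pose M := Num.bound (C ^+ j).
have CM : C ^+ j < M%:R by apply: archi_boundP; rewrite exprn_ge0.
have j0 : 0 < 2 ^+ j * (r / 2) by rewrite mulr_gt0// exprn_gt0.
exists M; exists (delta / (2 ^+ j * (r / 2))); first by rewrite divr_gt0.
move=> s /andP[s0 sd].
have sj : 2 ^+ j * ((r * s) / 2) <= delta.
  by move: sd; rewrite ltr_pdivlMr// => /ltW; apply: le_trans; lra.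
pose V := m (ball p ((rho + r) * s)).
have V0 : (0 < V)%E by apply: p_spt; rewrite mulr_gt0// addr_gt0.
have Vfin : V \is a fin_num by apply: (mball_fin m_finite (ball_borel _ _)); exact: subset_refl.
have [[l [lM lS lcov]]|[l [lM lS lsep]]] :=
    separated_or_cover (A `&` ball p (rho * s)) (r * s) M.
  (* Beyond the list the sequence takes the value [p], which is a point of [A]. *)
  exists (nth p l); split=> [k|x Ax px].
    have [kl|kl] := ltnP k (size l); last by rewrite nth_default.
    by have [] := lS _ (mem_nth p kl).
  have [y yl xy] := lcov x (conj Ax px).
  exists (index y l); first by rewrite (leq_trans _ lM)// index_mem.
  by apply/in_ball; rewrite nth_index// metric_sym.
exfalso.
have Cj0 : 0 <= C ^+ j by rewrite exprn_ge0.
have lV x : x \in l -> (V <= (C ^+ j)%:E * m (ball x (r * s / 2)))%E.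
  move=> /lS[Ax /in_ball px]; apply: (le_trans _ (doubling_iter Ax _ sj)); last first.
    by rewrite divr_gt0// mulr_gt0.
  apply: le_mball; [exact: ball_borel..|apply: sub_ball].
  rewrite metric_sym; have : (2 * rho + r) * s <= 2 ^+ j * (r / 2) * s by rewrite ler_pM2r.
  by lra.
have := separated_measure Cj0 lsep lV (ltW V0); rewrite lM.
have UV : (m (\big[setU/set0]_(x <- l) ball x (r * s / 2)) <= V)%E.
  apply: le_mball; last 1 first.
  - rewrite -bigcup_seq => y [x /= /lS[_ /in_ball px]]; apply: sub_ball.
    by have := mulr_gt0 r0 s0; lra.
  - by apply: bigsetU_measurable => y _; exact: ball_borel.
  - exact: ball_borel.
move=> /le_trans/(_ (lee_wpmul2l _ UV)); rewrite lee_fin => /(_ Cj0).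
rewrite -(fineK Vfin) -!EFinM lee_fin ler_pM2r ?leNgt ?CM//.
by rewrite fine_gt0// V0 ltey_eq Vfin.
Qed.

End blowup_estimates.

(** * Completion of a pseudometric *)

Record pseudometric (R : realType) (T : Type) := Pseudometric {
  pdist :> T -> T -> R ;
  pdistxx : forall a, pdist a a = 0 ;
  pdist_sym : forall a b, pdist a b = pdist b a ;
  pdist_triangle : forall b a c, pdist a c <= pdist a b + pdist b c }.

(* A point y of the completion is encoded by the function a |-> d(y, a). *)
Record completion (R : realType) (T : Type) (d : pseudometric R T) :=
  Completion {
  dist_to :> T -> R ;
  dist_to_lip : forall a b, dist_to a <= dist_to b + d a b ;
  dist_to_ge : forall a b, d a b <= dist_to a + dist_to b ;
  dist_to_inf : forall e, 0 < e -> exists a, dist_to a < e }.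

Section completion.
Context {R : realType} {T : pointedType} (d : pseudometric R T).
Implicit Types (f g h : completion d) (a b : T).

Lemma completion_eqP f g : (forall a, f a = g a) -> f = g.
Proof.
case: f g => f f1 f2 f3 [g g1 g2 g3] /= /funext fg.
by move: f1 f2 f3 g1 g2 g3; rewrite fg => *; f_equal; apply: Prop_irrelevance.
Qed.

HB.instance Definition _ := gen_eqMixin (completion d).
HB.instance Definition _ := gen_choiceMixin (completion d).

Definition completion_embed a : completion d.
Proof.
apply: (@Completion _ _ _ (d a)).
- by move=> b c; rewrite (pdist_sym d b c); exact: pdist_triangle.
- by move=> b c; rewrite (pdist_sym d a b); exact: pdist_triangle.
- by move=> e e0; exists a; rewrite pdistxx.
Defined.

Let diffs f g := [set `|f a - g a| | a in [set: T]].

(** For f = d(y, .) and g = d(y', .) the supremum is d(y, y'), as in the Kuratowski embedding. The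
    functions may be unbounded, but their difference is bounded by [diffs_le]. *)
Let completion_dist f g : R := sup (diffs f g).

Let diffs_le f g b a : `|f a - g a| <= f b + g b.
Proof.
have := dist_to_lip f a b; have := dist_to_lip g a b.
have := dist_to_ge f a b; have := dist_to_ge g a b.
by rewrite ler_norml; lra.
Qed.

Let has_sup_diffs f g : has_sup (diffs f g).
Proof.
split; first by exists `|f point - g point|, point.
by exists (f point + g point) => _ [a _ <-]; exact: diffs_le.
Qed.

Let le_completion_dist f g a : `|f a - g a| <= completion_dist f g.
Proof. by apply: sup_upper_bound => //; exists a. Qed.

Let completion_dist_le f g e :
  (forall a, `|f a - g a| <= e) -> completion_dist f g <= e.
Proof.
move=> fg; apply: ge_sup; first by exists `|f point - g point|, point.
by move=> _ [a _ <-].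
Qed.

Let completion_dist_ge0 f g : 0 <= completion_dist f g.
Proof. exact: le_trans (normr_ge0 _) (le_completion_dist f g point). Qed.

Let completion_distxx f : completion_dist f f = 0.
Proof.
apply/eqP; rewrite eq_le completion_dist_ge0 andbT.
by apply: completion_dist_le => a; rewrite subrr normr0.
Qed.

Let completion_dist_positivity f g : completion_dist f g = 0 -> f = g.
Proof.
move=> fg; apply: completion_eqP => a.
by have := le_completion_dist f g a; rewrite fg normr_le0 subr_eq0 => /eqP.
Qed.

Let completion_dist_sym f g : completion_dist f g = completion_dist g f.
Proof.
by rewrite /completion_dist; congr sup; apply/seteqP; split=> _ [a _ <-];
  exists a => //; rewrite distrC.
Qed.

Let completion_dist_triangle g f h :
  completion_dist f h <= completion_dist f g + completion_dist g h.
Proof.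
apply: completion_dist_le => a.
rewrite (le_trans (ler_distD (g a) _ _))// lerD//; exact: le_completion_dist.
Qed.

HB.instance Definition _ := @isMetric.Build R (completion d) completion_dist
  completion_distxx completion_dist_positivity completion_dist_sym
  completion_dist_triangle.

HB.instance Definition _ := isPointed.Build (completion d) (completion_embed point).

Lemma le_mdist_completion f g a : `|f a - g a| <= mdist f g.
Proof. exact: le_completion_dist. Qed.

Lemma mdist_completion_le f g e :
  (forall a, `|f a - g a| <= e) -> mdist f g <= e.
Proof. exact: completion_dist_le. Qed.

(** The lower bound comes from testing the supremum at [a], the upper bound from the Lipschitz and
    triangle conditions on [f]. *)
Lemma mdist_embed f a : mdist f (completion_embed a) = f a.
Proof.
apply/eqP; rewrite eq_le; apply/andP; split.
  apply: mdist_completion_le => b /=; rewrite ler_norml.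
  have := dist_to_lip f b a; have := dist_to_ge f b a.
  have := dist_to_lip f a b; rewrite (pdist_sym d b a); lra.
have := le_mdist_completion f (completion_embed a) a.
rewrite /= pdistxx subr0; apply: le_trans; exact: ler_norm.
Qed.

Lemma mdist_embed2 a b :
  mdist (completion_embed a) (completion_embed b) = d a b.
Proof. by rewrite mdist_embed. Qed.

Lemma dense_embed f e : 0 < e -> exists a, mdist f (completion_embed a) < e.
Proof. by move=> /(dist_to_inf f)[a fa]; exists a; rewrite mdist_embed. Qed.

(** A Cauchy filter converges pointwise, and uniformly because the distance is a supremum. Uniform
    closeness ([near_l]) carries the three defining conditions over to the limit function. *)
Let completion_complete (F : set_system (completion d)) :
  ProperFilter F -> cauchy F -> cvg F.
Proof.
move=> FF /cauchyP; rewrite /cauchy_ex => cF.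
have cFa a : cvg ((fun f : completion d => f a) @ F).
  apply/cauchy_cvgP/cauchyP => e e0.
  have [f Ff] := cF _ e0; exists (f a).
  apply: (@filterS _ F _ (ball f _) _ _ Ff) => g; rewrite ballEmdist => fg.
  exact: le_lt_trans (le_mdist_completion f g a) fg.
pose l a : R := lim ((fun f : completion d => f a) @ F).
have near_l e : 0 < e -> exists2 f : completion d, F (ball f e) &
    forall a, `|f a - l a| <= e.
  move=> e0; have [f Ff] := cF _ e0; exists f => // a.
  have fa : F [set g : completion d | `|f a - g a| <= e].
    apply: (@filterS _ F _ (ball f e) _ _ Ff) => g; rewrite ballEmdist => fg.
    exact: le_trans (le_mdist_completion f g a) (ltW fg).
  rewrite ler_distlC; apply/andP; split.
    apply: limr_ge; first exact: cFa.
    by apply: (@filterS _ F _ _ _ _ fa) => g /=; rewrite ler_norml => /andP[? ?]; lra.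
  apply: limr_le; first exact: cFa.
  by apply: (@filterS _ F _ _ _ _ fa) => g /=; rewrite ler_norml => /andP[? ?]; lra.
have lip a b : l a <= l b + d a b.
  apply/ler_addgt0Pr => e e0.
  have [|f _ fl] := near_l (e / 2); first by rewrite divr_gt0.
  have := dist_to_lip f a b; move: (fl a) (fl b); rewrite !ler_norml.
  by move=> /andP[? ?] /andP[? ?] ?; lra.
have ge a b : d a b <= l a + l b.
  apply/ler_addgt0Pr => e e0.
  have [|f _ fl] := near_l (e / 2); first by rewrite divr_gt0.
  have := dist_to_ge f a b; move: (fl a) (fl b); rewrite !ler_norml.
  by move=> /andP[? ?] /andP[? ?] ?; lra.
have inf e : 0 < e -> exists a, l a < e.
  move=> e0; have e20 : 0 < e / 2 by rewrite divr_gt0.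
  have [f _ fl] := near_l _ e20; have [a fa] := dist_to_inf f e20.
  by exists a; have := fl a; rewrite ler_norml => /andP[? ?]; lra.
pose L : completion d := Completion lip ge inf.
apply/cvg_ex; exists L; apply/metricType_numDomainType.fcvgrPdist_lt => e e0.
have [|f Ff fl] := near_l (e / 3); first by rewrite divr_gt0.
apply: (@filterS _ F _ (ball f _) _ _ Ff) => g; rewrite ballEmdist/= => fg.
have Lf : mdist L f <= e / 3.
  by apply: mdist_completion_le => a; rewrite distrC; exact: fl.
by have := metric_triangle L f g; lra.
Qed.

HB.instance Definition _ :=
  Uniform_isComplete.Build (completion d) completion_complete.

End completion.

Section completion_separable.
Context {R : realType} (T : pointedType) (d : pseudometric R T).

Lemma completion_separable : countable [set: T] ->
  exists2 D : set (completion d), countable D & dense D.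
Proof.
move=> cT; exists (range (completion_embed d)).
  by apply: sub_countable cT; exact: card_image_le.
move=> O [f Of] oO; have /nbhs_ballP[e /= e0 eO] := open_nbhs_nbhs (conj oO Of).
have [a fa] := dense_embed f e0.
by exists (completion_embed d a); split; [apply: eO; rewrite ballEmdist|exists a].
Qed.

End completion_separable.

Section completion_polish.
Context {R : realType} (d : pseudometric R (nat * nat)%type).

HB.instance Definition _ := Topological_isSeparable.Build (completion d)
  (completion_separable d (countableP _)).

End completion_polish.

(** * Coding a weighted tree by intervals *)

Section tree_coding.
Context {R : realType} (wt : seq nat -> R).
(** The root is exempt here and in [wt_tree]: its weight would be the total mass, possibly infinite.
    Below it, every node has finitely many children of positive weight. *)
Hypothesis wt_ge0 : forall t, t != [::] -> 0 <= wt t.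
Hypothesis wt_tree : forall t, t != [::] ->
  exists b0, forall b, (b0 <= b)%N -> wt t = \sum_(j < b) wt (rcons t j).
Implicit Types (t : seq nat) (u : R) (j n : nat).

Let S t j : R := \sum_(l < j) wt (rcons t l).

Let S0 t : S t 0 = 0. Proof. by rewrite /S big_ord0. Qed.

Let SS t j : S t j.+1 = S t j + wt (rcons t j).
Proof. by rewrite /S big_ord_recr. Qed.

Let le_S t i j : (i <= j)%N -> S t i <= S t j.
Proof.
move=> /subnKC <-; elim: (j - i)%N => [|k IH]; first by rewrite addn0.
rewrite addnS SS (le_trans IH)// lerDl; apply: wt_ge0.
by rewrite -size_eq0 size_rcons.
Qed.

Let S_le t j : t != [::] -> S t j <= wt t.
Proof.
move=> /wt_tree[b0 /(_ (maxn b0 j) (leq_maxl _ _)) ->].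
exact: le_S (leq_maxr _ _).
Qed.

(* The leaves below node t are coded by the reals of an interval of length
   [wt t]; the intervals of the children of t fill it from left to right. *)
Let left_end t : R := \sum_(k < size t) S (take k t) (nth 0%N t k).

Let left_end_rcons t j : left_end (rcons t j) = left_end t + S t j.
Proof.
rewrite /left_end size_rcons big_ord_recr/= nth_rcons ltnn eqxx.
rewrite -cats1 take_size_cat//; congr (_ + _); apply: eq_bigr => i _.
rewrite takel_cat; last exact: ltnW.
by rewrite nth_cat ltn_ord.
Qed.

Let I t : set R := [set u | left_end t <= u < left_end t + wt t].

Let I_rconsE t j u :
  I (rcons t j) u = (left_end t + S t j <= u < left_end t + S t j.+1) :> Prop.
Proof. by rewrite /I/= left_end_rcons SS addrA. Qed.

Let exists_child t u n : left_end t <= u < left_end t + S t n ->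
  exists j, I (rcons t j) u.
Proof.
move=> /andP[tu]; elim: n => [|n IH]; first by rewrite S0 addr0 ltNge tu.
move=> un; have [/IH//|nu] := ltP u (left_end t + S t n).
by exists n; rewrite I_rconsE nu.
Qed.

Let I_child t u : t != [::] -> I t u -> exists j, I (rcons t j) u.
Proof.
move=> t0 tu; have [b0 /(_ _ (leqnn _)) wtE] := wt_tree t0.
by apply: (@exists_child t u b0); rewrite /S -wtE.
Qed.

Let I_rcons_sub t j : t != [::] -> I (rcons t j) `<=` I t.
Proof.
move=> t0 u; rewrite I_rconsE /I/= => /andP[tu ut]; apply/andP; split.
  by rewrite (le_trans _ tu)// lerDl -(S0 t) le_S.
by rewrite (lt_le_trans ut)// lerD2l S_le.
Qed.

Let I_inj t u i j : I (rcons t i) u -> I (rcons t j) u -> i = j.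
Proof.
rewrite !I_rconsE => /andP[iu ui] /andP[ju uj].
by apply/eqP; rewrite eqn_leq; apply/andP; split; rewrite leqNgt; apply/negP;
  move=> /(le_S t) ?; lra.
Qed.

Let D : set R := \bigcup_j I [:: j].

(** The address of [u]: descend at each node to the child whose interval contains [u]. The default 0
    is reached only for [u] outside [D]. *)
Let prefix u := fix prefix n : seq nat :=
  if n is n'.+1 then
    rcons (prefix n') (xget 0%N [set j | I (rcons (prefix n') j) u])
  else [::].

Let size_prefix u n : size (prefix u n) = n.
Proof. by elim: n => //= n IH; rewrite size_rcons IH. Qed.

Let xget_child t u j : I (rcons t j) u ->
  I (rcons t (xget 0%N [set j | I (rcons t j) u])) u.
Proof. by move=> ju; apply: (xgetI 0%N (P := [set j | I (rcons t j) u]) (x := j)). Qed.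

Let prefixP u n : D u -> I (prefix u n.+1) u.
Proof.
move=> [j _ ju]; elim: n => [|n IH]; first exact: (@xget_child [::] u j ju).
have [|k kI] := I_child _ IH; last exact: xget_child kI.
by rewrite -size_eq0 size_prefix.
Qed.

Let prefix_I t u : t != [::] -> I t u -> prefix u (size t) = t.
Proof.
elim/last_ind: t => // t j IH _ tju; rewrite size_rcons /=.
have -> : prefix u (size t) = t.
  by have [->//|t0] := eqVneq t [::]; exact: IH t0 (I_rcons_sub t0 tju).
by congr rcons; apply: xget_unique => // k kI; exact: I_inj kI tju.
Qed.

Let I_sub_D t : t != [::] -> I t `<=` D.
Proof.
elim/last_ind: t => // t j IH _ u; have [->|t0] := eqVneq t [::].
  by exists j.
by move=> /(I_rcons_sub t0)/(IH t0).
Qed.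

Let code u n := last 0%N (prefix u n.+1).

Let mkseq_code u n : mkseq (code u) n = prefix u n.
Proof. by elim: n => //= n IH; rewrite mkseqS IH /code /= last_rcons. Qed.

(** The cylinder of all [u] whose code starts with [t] is an interval, which yields both its
    measurability and its measure. *)
Let I_code t : t != [::] ->
  I t = [set u | D u /\ mkseq (code u) (size t) = t].
Proof.
move=> t0; apply/seteqP; split=> u.
  by move=> tu; split; [exact: I_sub_D tu|rewrite mkseq_code prefix_I].
move=> [Du]; rewrite mkseq_code => tE; rewrite -tE.
have : (0 < size t)%N by rewrite lt0n size_eq0.
by case: (size t) => // n _; exact: prefixP.
Qed.

Let I_itv t : I t = `[left_end t, left_end t + wt t[%classic.
Proof. by apply/seteqP; split=> u /=; rewrite in_itv. Qed.

Let D_borel : measurable (D : set (measurableTypeR R)).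
Proof. by apply: bigcup_measurable => j _; rewrite I_itv; exact: measurable_itv. Qed.

(** A half-open interval that contains a point has positive length. Hence every prefix of every code
    from [D] has positive weight, not only of almost every one; the limit points are built from
    these codes. *)
Lemma tree_coding : exists (nu : {measure set (measurableTypeR R) -> \bar R})
    (D : set (measurableTypeR R)) (code : measurableTypeR R -> nat -> nat),
  [/\ measurable D, nu (~` D) = 0%E,
    forall u n, D u -> 0 < wt (mkseq (code u) n.+1) &
    forall t, t != [::] ->
      let A := [set u | D u /\ mkseq (code u) (size t) = t] in
      measurable A /\ nu A = (wt t)%:E].
Proof.
exists (mrestr lebesgue_measure D_borel), D, code; split=> //.
- by rewrite /= /mrestr setICl measure0.
- move=> u n Du; rewrite mkseq_code; have := prefixP n Du.
  by rewrite /I/= => /andP[nu un]; have := le_lt_trans nu un; rewrite ltrDl.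
move=> t t0 /=; rewrite -I_code//.
split; first by rewrite I_itv; exact: measurable_itv.
rewrite /mrestr (setIidl (I_sub_D t0)) I_itv.
rewrite lebesgue_measure_itv/= lte_fin ltrDl; case: ifPn => [_|].
  by rewrite -EFinB addrAC subrr add0r.
by rewrite -leNgt => w0; congr EFin; apply/eqP; rewrite eq_le w0 wt_ge0.
Qed.

End tree_coding.

(** * Ultralimits of nets and of cell masses *)

Section ultralimits.
Context {R : realType} (omega : set_system nat) {UF : UltraFilter omega}.

(** Compactness of [-c, c] gives a cluster point, and a cluster point of an ultrafilter is a
    limit. *)
Lemma ultra_bounded_cvg (f : nat -> R) (c : R) :
  omega [set i | `|f i| <= c] -> cvg (f @ omega).
Proof.
move=> fc; have := @segment_compact R (- c) c (f @ omega) _.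
case=> [|l [_ lcl]].
  by apply: (@filterS _ omega _ _ _ _ fc) => i /=; rewrite in_itv/= ler_norml.
apply/cvg_ex; exists l; apply/cvgrPdist_lt => e e0.
have [//|far] := in_ultra_setVsetC (F := omega) [set i | `|l - f i| < e].
have ffar : (f @ omega) (f @` ~` [set i | `|l - f i| < e]).
  by apply: (@filterS _ omega _ _ _ _ far) => i; exists i.
have [x [[i nfi <-]]] := lcl _ _ ffar (nbhsx_ballx l e e0).
by rewrite /ball/= => /nfi.
Qed.

Definition ulim (f : nat -> R) : R := lim (f @ omega).

Lemma ulimP (f : nat -> R) (c : R) : omega [set i | `|f i| <= c] ->
  forall e, 0 < e -> omega [set i | `|ulim f - f i| < e].
Proof. by move=> /ultra_bounded_cvg/cvgrPdist_lt. Qed.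

Lemma ulim_unique (f : nat -> R) (c l : R) : omega [set i | `|f i| <= c] ->
  (forall e, 0 < e -> omega [set i | `|l - f i| <= e]) -> ulim f = l.
Proof.
move=> fc fl; apply/eqP; rewrite -subr_eq0 -normr_le0; apply/ler_addgt0Pl => e e0.
have e20 : 0 < e / 2 by rewrite divr_gt0.
have [i [/= fi li]] := filter_ex (filterI (ulimP fc e20) (fl _ e20)).
have := ler_distD (f i) (ulim f) l; rewrite (distrC (f i)); lra.
Qed.

Lemma ulim_le (f : nat -> R) (c b : R) : omega [set i | `|f i| <= c] ->
  omega [set i | f i <= b] -> ulim f <= b.
Proof.
move=> fc fb; apply/ler_addgt0Pr => e e0.
have [i [/= + fi]] := filter_ex (filterI (ulimP fc e0) fb).
by rewrite ltr_norml => /andP[_ ?]; lra.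
Qed.

Lemma ulim_ge (f : nat -> R) (c b : R) : omega [set i | `|f i| <= c] ->
  omega [set i | b <= f i] -> b <= ulim f.
Proof.
move=> fc fb; apply/ler_addgt0Pr => e e0.
have [i [/= + fi]] := filter_ex (filterI (ulimP fc e0) fb).
by rewrite ltr_norml => /andP[? _]; lra.
Qed.

Lemma ulim_eq (f g : nat -> R) (c : R) : omega [set i | `|f i| <= c] ->
  omega [set i | f i = g i] -> ulim f = ulim g.
Proof.
move=> fc fg; apply: (ulim_unique fc) => e e0.
have gc : omega [set i | `|g i| <= c].
  by apply: (@filterS _ omega _ _ _ _ (filterI fg fc)) => i /= [<-].
apply: (@filterS _ omega _ _ _ _ (filterI fg (ulimP gc e0))) => i /= [->].
exact: ltW.
Qed.

Lemma ulim_sum n (f : 'I_n -> nat -> R) (c : 'I_n -> R) :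
  (forall j, omega [set i | `|f j i| <= c j]) ->
  ulim (fun i => \sum_(j < n) f j i) = \sum_(j < n) ulim (f j).
Proof.
move=> fc; apply: (@ulim_unique _ (\sum_(j < n) c j)).
  have H : omega [set i | forall j, `|f j i| <= c j] by exact: filter_forall.
  apply: (@filterS _ omega _ _ _ _ H) => i /= fi.
  by rewrite (le_trans (ler_norm_sum _ _ _))//; apply: ler_sum.
move=> e e0; have en0 : 0 < e / n.+1%:R by rewrite divr_gt0.
have H : omega [set i | forall j, `|ulim (f j) - f j i| < e / n.+1%:R].
  by apply: filter_forall => j; have := ulimP (fc j) en0.
apply: (@filterS _ omega _ _ _ _ H) => i /= fi.
rewrite -sumrB (le_trans (ler_norm_sum _ _ _))//.
apply: (@le_trans _ _ (\sum_(j < n) (e / n.+1%:R))).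
  by apply: ler_sum => j _; exact: ltW.
rewrite sumr_const card_ord -[leLHS]mulr_natl mulrCA ger_pMr// ler_pdivrMr// mul1r.
by rewrite ler_nat.
Qed.

End ultralimits.

(* The sets A i carry the total boundedness; by core_full they have
   asymptotically full mass on bounded balls. *)
Record precompact_core {R : realType} (omega : set_system nat)
    (X : nat -> pmms R) (A : forall i, set (X i)) : Prop := PrecompactCore {
  core_base : forall i, A i (basept (X i)) ;
  core_borel : forall i, measurable (A i : set (borel (X i))) ;
  core_mass : forall n : nat, exists eta : R,
    omega [set i | (pmeas (X i) (ball (basept (X i)) n%:R) <= eta%:E)%E] ;
  core_nets : forall n : nat, exists M : nat,
    omega [set i | exists z : nat -> X i, (forall l, A i (z l)) /\
      forall x, A i x -> ball (basept (X i)) n.+1%:R x ->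
        exists2 l, (l < M)%N & ball (z l) n.+1%:R^-1 x] ;
  core_full : forall (n : nat) (e : R), 0 < e ->
    omega [set i | (pmeas (X i) (ball (basept (X i)) n%:R `\` A i) <= e%:E)%E] ;
  core_base_mass : forall e : R, 0 < e -> exists2 c : R, 0 < c &
    omega [set i | (c%:E <= pmeas (X i) (ball (basept (X i)) e))%E] }.

Fixpoint last_true (P : nat -> bool) (k : nat) : nat :=
  if k is k'.+1 then if P k' then k' else last_true P k' else 0.

Lemma last_true_lt (P : nat -> bool) k : (last_true P k.+1 <= k)%N.
Proof.
elim: k => [|k IH] /=; first by case: ifP.
by case: (P k.+1) => //; exact: leqW.
Qed.

Lemma last_trueP (P : nat -> bool) k l : (l < k)%N -> P l -> P (last_true P k).
Proof.
elim: k => //= k IH; rewrite ltnS leq_eqVlt => /orP[/eqP -> Pk|lk Pl].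
  by rewrite Pk.
by case: ifP => // _; exact: IH.
Qed.

(** * Normalised nets *)

Section net_codes.
Context {R : realType} (omega : set_system nat) {UF : UltraFilter omega}.
Variables (X : nat -> pmms R) (A : forall i, set (X i)).
Arguments A : clear implicits.
Hypothesis core : precompact_core omega A.
Local Notation p i := (basept (X i)).

(** Net points are kept within n + 2 of the base point, so that distances between labels are bounded
    in i and have ultralimits. Indices from [M n] on all denote the base point, which thus has a
    label at every scale. *)
Lemma exists_net_points : exists (M : nat -> nat) (z : nat -> nat -> forall i, X i),
  [/\ forall n l i, A i (z n l i),
    forall n l i, mdist (p i) (z n l i) <= n%:R + 2,
    forall n l i, (M n <= l)%N -> z n l i = p i &
    forall n, omega [set i | forall x, A i x -> ball (p i) n.+1%:R x ->
      exists2 l, (l < M n)%N & ball (z n l i) n.+1%:R^-1 x]].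
Proof.
have arith (a b c e k : R) :
  c <= a + b -> e <= 1 -> a < k + 1 -> b < e -> c <= k + 2 by lra.
have [M MP] := choice (core_nets core).
pose good n i (z : nat -> X i) := (forall l, A i (z l)) /\
  forall x, A i x -> ball (p i) n.+1%:R x ->
    exists2 l, (l < M n)%N & ball (z l) n.+1%:R^-1 x.
(* A net exists only for omega-a.e. i; for the other indices all points are the base point. *)
have exz n i : exists z : nat -> X i,
    (forall l, A i (z l)) /\ ((exists z', good n i z') -> good n i z).
  have [[z zP]|noz] := pselect (exists z', good n i z').
    by exists z; split=> // l; have [] := zP.
  by exists (fun=> p i); split=> // l; exact: core_base core i.
pose z0 n i := sval (cid (exz n i)).
have z0A n i l : A i (z0 n i l) by exact: (svalP (cid (exz n i))).1.
have z0good n i : (exists z', good n i z') -> good n i (z0 n i).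
  exact: (svalP (cid (exz n i))).2.
(* Replacing far points loses nothing: a net point within 1/(n+1) <= 1 of a point of the ball of
   radius n + 1 is closer than n + 2 to the base point. *)
pose z n l i := if (l < M n)%N && (mdist (p i) (z0 n i l) <= n%:R + 2)
                then z0 n i l else p i.
exists M, z; split.
- by move=> n l i; rewrite /z; case: ifP => // _; exact: core_base core i.
- move=> n l i; rewrite /z; case: ifP => [/andP[_ //]|_].
  by rewrite mdistxx addr_ge0.
- by move=> n l i nl; rewrite /z ltnNge nl.
move=> n; apply: (@filterS _ omega _ _ _ _ (MP n)) => i /z0good[_ zcov] x Ax px.
have [l lM lx] := zcov x Ax px; exists l => //.
suff -> : z n l i = z0 n i l by [].
move: px lx => /in_ball px /in_ball; rewrite metric_sym => lx.
rewrite /z lM /= (arith _ _ _ _ _ (metric_triangle (p i) x (z0 n i l)) _ _ lx)//.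
  by rewrite invf_le1// ler1n.
by rewrite natr1.
Qed.

End net_codes.

(** * Limit distances and limit weights of code cells *)

Section limit_weights.
Context {R : realType} (omega : set_system nat) {UF : UltraFilter omega}.
Variables (X : nat -> pmms R) (A : forall i, set (X i)).
Arguments A : clear implicits.
Hypothesis core : precompact_core omega A.
Variables (M : nat -> nat) (z : nat -> nat -> forall i, X i).
Arguments z : clear implicits.
Local Notation p i := (basept (X i)).
Hypotheses (z_le : forall n l i, mdist (p i) (z n l i) <= n%:R + 2)
  (z_base : forall n l i, (M n <= l)%N -> z n l i = p i)
  (z_net : forall n, omega [set i | forall x, A i x -> ball (p i) n.+1%:R x ->
      exists2 l, (l < M n)%N & ball (z n l i) n.+1%:R^-1 x]).

Let omegaS (P Q : set nat) : P `<=` Q -> omega P -> omega Q.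
Proof. by move=> PQ oP; apply: (@filterS _ omega _ _ _ PQ oP). Qed.

Let omegaI (P Q : set nat) : omega P -> omega Q -> omega (P `&` Q).
Proof. exact: filterI. Qed.

(** The label (n, l) stands for the l-th point of the net at scale 1/(n+1), in all spaces [X i] at
    once. *)
Let dist_z (a b : nat * nat) i := mdist (z a.1 a.2 i) (z b.1 b.2 i).

Let dist_z_bounded a b :
  omega [set i | `|dist_z a b i| <= (a.1%:R + 2) + (b.1%:R + 2)].
Proof.
apply: (omegaS (P := setT)); last exact: filterT.
move=> i _ /=; rewrite ger0_norm ?mdist_ge0//.
rewrite (le_trans (metric_triangle _ (p i) _))// lerD//.
by rewrite metric_sym.
Qed.

Let limit_dist a b : R := ulim omega (dist_z a b).

Let limit_distP a b e : 0 < e -> omega [set i | `|limit_dist a b - dist_z a b i| < e].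
Proof. exact: (ulimP (dist_z_bounded a b)). Qed.

Let limit_distxx a : limit_dist a a = 0.
Proof.
apply: (ulim_unique (dist_z_bounded a a)) => e e0.
apply: (omegaS (P := setT)); last exact: filterT.
by move=> i _ /=; rewrite /dist_z mdistxx subrr normr0 ltW.
Qed.

Let limit_dist_sym a b : limit_dist a b = limit_dist b a.
Proof.
by rewrite /limit_dist; congr ulim; apply/funext => i; rewrite /dist_z metric_sym.
Qed.

Let limit_dist_triangle b a c : limit_dist a c <= limit_dist a b + limit_dist b c.
Proof.
apply/ler_addgt0Pr => e e0; have e30 : 0 < e / 3 by rewrite divr_gt0.
have [i [/= ac [ab bc]]] := filter_ex (filterI (limit_distP a c e30)
  (filterI (limit_distP a b e30) (limit_distP b c e30))).
have := metric_triangle (z a.1 a.2 i) (z b.1 b.2 i) (z c.1 c.2 i).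
move: ac ab bc; rewrite -!/(dist_z _ _ _) !ltr_norml => /andP[? ?] /andP[? ?] /andP[? ?].
lra.
Qed.

Definition net_pseudometric : pseudometric R (nat * nat)%type :=
  Pseudometric limit_distxx limit_dist_sym limit_dist_triangle.

Lemma net_pseudometricP a b e : 0 < e -> omega [set i |
  `|net_pseudometric a b - mdist (z a.1 a.2 i) (z b.1 b.2 i)| < e].
Proof. exact: limit_distP. Qed.

Lemma net_pseudometric_le a b c :
  omega [set i | mdist (z a.1 a.2 i) (z b.1 b.2 i) <= c] -> net_pseudometric a b <= c.
Proof. exact: (ulim_le (dist_z_bounded a b)). Qed.

Lemma net_pseudometric_ge a b c :
  omega [set i | c <= mdist (z a.1 a.2 i) (z b.1 b.2 i)] -> c <= net_pseudometric a b.
Proof. exact: (ulim_ge (dist_z_bounded a b)). Qed.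

(** So (0, M 0) can serve as the label of the limit base point and agrees with (n, M n) at each
    scale. *)
Lemma net_pseudometric_base n l : (M n <= l)%N ->
  net_pseudometric (0, M 0)%N (n, l) = 0.
Proof.
move=> nl; apply/eqP; rewrite eq_le; apply/andP; split.
  apply: net_pseudometric_le; apply: (omegaS (P := setT)); last exact: filterT.
  by move=> i _ /=; rewrite !z_base// mdistxx.
apply: net_pseudometric_ge; apply: (omegaS (P := setT)); last exact: filterT.
by move=> i _ /=; exact: mdist_ge0.
Qed.

(* The largest index is tested first, so that points close to the base point
   z n (M n) receive the index M n. *)
Definition net_index n i (x : X i) : nat :=
  last_true (fun l => mdist (z n l i) x < n.+1%:R^-1) (M n).+1.

Definition net_code i (x : X i) (k : nat) : nat :=
  if k is n.+1 then net_index n x else Num.truncn (mdist (p i) x).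

Definition cell i (t : seq nat) : set (X i) :=
  [set x | mkseq (net_code x) (size t) = t].
Arguments cell : clear implicits.

Lemma net_index_le n i (x : X i) : (net_index n x <= M n)%N.
Proof. exact: last_true_lt. Qed.

Lemma net_index_base n i : net_index n (p i) = M n.
Proof. by rewrite /net_index /= z_base// mdistxx invr_gt0 ltr0n. Qed.

Lemma net_index_near_base n i (x : X i) :
  ball (p i) n.+1%:R^-1 x -> net_index n x = M n.
Proof. by move=> /in_ball px; rewrite /net_index /= z_base// px. Qed.

Lemma mdist_net_index n : omega [set i | forall x, A i x ->
  ball (p i) n.+1%:R x -> mdist (z n (net_index n x) i) x < n.+1%:R^-1].
Proof.
apply: omegaS (z_net n) => i /= H x Ax px.
have [l lM /in_ball lx] := H x Ax px.
apply: (last_trueP (P := fun l => mdist (z n l i) x < n.+1%:R^-1)) lx.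
exact: leqW.
Qed.

Lemma net_code0P i (x : X i) n : (net_code x 0 < n)%N <-> ball (p i) n%:R x.
Proof. by rewrite in_ball /= truncn_lt_nat// mdist_ge0. Qed.

Lemma net_index_borel n j i :
  measurable ([set x : X i | net_index n x = j] : set (borel (X i))).
Proof.
rewrite /net_index; elim: (M n).+1 => [|k IH] /=.
  have [->|j0] := eqVneq j 0%N.
    by rewrite (_ : [set _ | _] = setT)//; apply/seteqP; split.
  rewrite (_ : [set _ | _] = set0)//; apply/seteqP; split=> // x /= /esym/eqP.
  by rewrite (negbTE j0).
pose B : set (borel (X i)) := ball (z n k i) n.+1%:R^-1.
have BP x : B x <-> mdist (z n k i) x < n.+1%:R^-1 by rewrite /B in_ball.
have mB : measurable B by exact: ball_borel.
rewrite (_ : [set _ | _] = (B `&` [set _ | k = j]) `|`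
  (~` B `&` [set x : X i | last_true (fun l => mdist (z n l i) x < n.+1%:R^-1) k = j])).
  apply: (@measurableU _ (borel (X i))).
    apply: (@measurableI _ (borel (X i))) => //.
    have [kj|kj] := pselect (k = j).
      by rewrite (_ : [set _ | _] = setT)//; apply/seteqP; split.
    by rewrite (_ : [set _ | _] = set0)//; apply/seteqP; split.
  apply: (@measurableI _ (borel (X i))) => //; exact: measurableC.
apply/seteqP; split=> x /=.
  case: ifPn => [/BP Bx <-|/negP nBx xj]; first by left.
  by right; split=> // /BP.
by move=> [[/BP -> //]|[nBx <-]]; case: ifPn => // /BP.
Qed.

Lemma cell_borel i t : measurable (cell i t : set (borel (X i))).
Proof.
elim/last_ind: t => [|t k IH].
  by rewrite (_ : cell i [::] = setT)//; apply/seteqP; split.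
rewrite (_ : cell i (rcons t k) =
    cell i t `&` [set x | net_code x (size t) = k]); last first.
  apply/seteqP; split=> x; rewrite /cell /= size_rcons mkseqS.
    by move=> /rcons_inj[].
  by move=> [-> ->].
apply: (@measurableI _ (borel (X i))) => //.
case: (size t) => [|n]; last exact: net_index_borel.
rewrite (_ : [set _ | _] = (ball (p i) k.+1%:R `\` ball (p i) k%:R)).
  by apply: (@measurableD _ (borel (X i))); exact: ball_borel.
apply/seteqP; split=> x /=.
  move=> <-; split; first exact/net_code0P.
  by move=> /net_code0P; rewrite ltnn.
move=> [/net_code0P + /net_code0P/negP]; rewrite -leqNgt ltnS => xk kx.
by apply/eqP; rewrite eqn_leq xk.
Qed.

Lemma cell_ball i N t : cell i (N :: t) `<=` ball (p i) N.+1%:R.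
Proof. by move=> x [xN _]; apply/net_code0P; rewrite /= xN. Qed.

Lemma finite_mass n : omega [set i | (pmeas (X i) (ball (p i) n%:R) < +oo)%E].
Proof.
have [eta] := core_mass core n; apply: omegaS => i /=.
by move=> /le_lt_trans; apply; rewrite ltry.
Qed.

Let mass t i : R := fine (pmeas (X i) (cell i t)).

(** The first entry N of a nonempty code confines the cell to the ball of radius N + 1. *)
Let mass_bounded t : t != [::] -> exists c, omega [set i | `|mass t i| <= c].
Proof.
case: t => // N t _; have [eta p0] := core_mass core N.+1.
exists eta; move: p0; apply: omegaS => i /= H.
have mN : (pmeas (X i) (cell i (N :: t)) <= eta%:E)%E.
  apply: le_trans H; apply: le_mball; [exact: cell_borel|exact: ball_borel|].
  exact: cell_ball.
rewrite /mass ger0_norm ?fine_ge0// -lee_fin fineK//.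
by rewrite ge0_fin_numE// (le_lt_trans mN)// ltry.
Qed.

Definition cell_weight t : R := ulim omega (mass t).

Lemma cell_weightP t e : t != [::] -> 0 < e -> omega [set i |
  `|cell_weight t - fine (pmeas (X i) (cell i t))| < e].
Proof. by move=> /mass_bounded[c tc]; exact: (ulimP tc). Qed.

Lemma cell_weight_ge0 t : t != [::] -> 0 <= cell_weight t.
Proof.
move=> /mass_bounded[c tc]; apply: (ulim_ge tc).
by apply: (omegaS (P := setT)); [move=> i _ /=; exact: fine_ge0|exact: filterT].
Qed.

Lemma cell_mass_fin t : t != [::] -> omega [set i | (pmeas (X i) (cell i t) < +oo)%E].
Proof.
case: t => // N t _; apply: omegaS (finite_mass N.+1) => i /=; apply: le_lt_trans.
by apply: le_mball; [exact: cell_borel|exact: ball_borel|exact: cell_ball].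
Qed.

(** A nonroot cell splits into a number of subcells bounded uniformly in i, and a finite sum
    commutes with the ultralimit. *)
Lemma cell_weight_tree t : t != [::] -> exists b0, forall b, (b0 <= b)%N ->
  cell_weight t = \sum_(j < b) cell_weight (rcons t j).
Proof.
move=> t0; exists (M (size t).-1).+1 => b Mb.
have t0' j : rcons t j != [::] by case: (t).
have [c tc] := mass_bounded t0.
have /choice[cj tcj] : forall j : 'I_b, exists c,
    omega [set i | `|mass (rcons t j) i| <= c].
  by move=> j; exact: mass_bounded.
rewrite /cell_weight -(ulim_sum tcj); apply: (ulim_eq tc).
apply: omegaS (cell_mass_fin t0) => i /= tfin.
have tE : cell i t = \big[setU/set0]_(j < b) cell i (rcons t j).
  rewrite -(bigcup_mkord b (fun j => cell i (rcons t j))).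
  apply/seteqP; split=> x.
    move=> xt; exists (net_code x (size t)); last first.
      by rewrite /cell /= size_rcons mkseqS xt.
    rewrite /=; move: t0 Mb; rewrite -size_eq0; case: (size t) => //= n _.
    by apply: leq_trans; rewrite ltnS; exact: net_index_le.
  by move=> [j _]; rewrite /cell /= size_rcons mkseqS => /rcons_inj[].
have massE : pmeas (X i) (cell i t) = (\sum_(j < b) pmeas (X i) (cell i (rcons t j)))%E.
  rewrite tE measure_bigsetU_ord//; first by move=> j; exact: cell_borel.
  apply/trivIsetP => j k _ _ jk; rewrite -subset0 => x [].
  rewrite /cell /= !size_rcons !mkseqS => /rcons_inj[_ xj] /rcons_inj[_ xk].
  by move: jk; rewrite -val_eqE /= -xj -xk eqxx.
rewrite /mass massE sum_fine// => j _.
rewrite ge0_fin_numE// (le_lt_trans _ tfin)//.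
apply: le_mball; [exact: cell_borel..|].
by rewrite tE -(bigcup_mkord b (fun j => cell i (rcons t j))) => x xj; exists j => /=.
Qed.

(** A cell that misses [A i] lies in the part of a ball outside [A i], whose mass tends to 0,
    whereas the cell has mass above half its limit weight. *)
Lemma core_cell_nonempty t : t != [::] -> 0 < cell_weight t ->
  omega [set i | exists x, A i x /\ cell i t x].
Proof.
move=> t0 w0; have w20 : 0 < cell_weight t / 2 by rewrite divr_gt0.
have /= tw := cell_weightP t0 w20; case: t t0 w0 w20 tw => // N t t0 w0 w20 tw.
have H := omegaI tw (omegaI (core_full core N.+1 w20) (cell_mass_fin t0)).
apply: omegaS H => i /= [wt [full tfin]]; apply: contrapT => /forallNP noA.
have : (pmeas (X i) (cell i (N :: t)) <= (cell_weight (N :: t) / 2)%:E)%E.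
  apply: le_trans full; apply: le_mball; first exact: cell_borel.
    by apply: (@measurableD _ (borel (X i))); [exact: ball_borel|exact: core_borel core i].
  by move=> x xt; split; [exact: cell_ball xt|move=> Ax; exact: noA (conj Ax xt)].
rewrite -(@fineK _ (pmeas (X i) _)); last by rewrite ge0_fin_numE.
by rewrite lee_fin; move: wt; rewrite ltr_norml => /andP[_]; lra.
Qed.

(** This cell contains the ball of radius 1/(n+1) about the base point, because [net_index] gives
    preference to the index [M k]. It will put the limit base point in the support. *)
Lemma base_cell_weight n : 0 < cell_weight (0%N :: mkseq M n.+1).
Proof.
have n0 : 0 < n.+1%:R^-1 :> R by rewrite invr_gt0.
have [c c0 cP] := core_base_mass core n0.
apply: (lt_le_trans c0); have t0 : 0%N :: mkseq M n.+1 != [::] by [].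
have [b tb] := mass_bounded t0; apply: (ulim_ge tb).
have H := omegaI cP (cell_mass_fin t0); apply: omegaS H => i /= [ci tfin].
rewrite -lee_fin fineK ?ge0_fin_numE//; apply: (le_trans ci).
apply: le_mball; [exact: ball_borel|exact: cell_borel|].
have n1 k : (k <= n)%N -> n.+1%:R^-1 <= k.+1%:R^-1 :> R.
  by move=> kn; rewrite lef_pV2 ?posrE// ler_nat.
move=> x px; rewrite /cell; apply: (@eq_from_nth _ 0%N); rewrite !size_mkseq//.
move=> [|k] kn.
  rewrite nth_mkseq//=; apply/eqP; rewrite -leqn0 -ltnS; apply/net_code0P.
  by apply: sub_ball_radius px; rewrite invf_le1// ler1n.
have kn' : (k < n.+1)%N.
  by move: kn; rewrite -[size _]/(size (mkseq M n.+1)).+1 size_mkseq.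
rewrite nth_mkseq// -[RHS]/(nth 0%N (mkseq M n.+1) k) nth_mkseq//.
apply: net_index_near_base.
by apply: sub_ball_radius px; exact: n1.
Qed.

End limit_weights.

Arguments cell {R X} M z i t _.

(** * The limit measure *)

Lemma continuous_borel {R : realType} {X : polishMetricType R} (phi : X -> R) :
  continuous phi -> @measurable_fun _ _ (borel X) R setT phi.
Proof.
move=> /continuousP cphi; apply: (measurability _ (RGenOpens.measurableE R)) => /=.
move=> _ [_ [a [b ->] <-]]; rewrite setTI; apply: open_borel.
by apply: cphi; exact: interval_open.
Qed.

Section limit_measure.
Context {R : realType} (d : pseudometric R (nat * nat)%type) (M : nat -> nat).
Variables (nu : {measure set (measurableTypeR R) -> \bar R})
  (D : set (measurableTypeR R)) (code : measurableTypeR R -> nat -> nat)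
  (wt : seq nat -> R).
Hypotheses (D_borel : measurable D) (nuD : nu (~` D) = 0%E)
  (wtP : forall t, t != [::] ->
    let A := [set u | D u /\ mkseq (code u) (size t) = t] in
    measurable A /\ nu A = (wt t)%:E).
Local Notation q := (completion_embed d (0, M 0)%N).
Local Notation K n l := (completion_embed d (n, l)%N).
(** By [d_code] the net points along a code form a Cauchy sequence; by [d_code_ge] a large first
    entry means far from [q], which gives finiteness on balls and a dominating function; [wt_base]
    gives mass near [q]. *)
Hypotheses
  (d_base : forall n, d (0, M 0)%N (n, M n) = 0)
  (d_code : forall u n m, D u -> (code u 0 <= n)%N -> (code u 0 <= m)%N ->
    d (n, code u n.+1) (m, code u m.+1) <= n.+1%:R^-1 + m.+1%:R^-1)
  (d_code_ge : forall u n, D u -> (code u 0 <= n)%N ->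
    (code u 0)%:R - n.+1%:R^-1 <= d (0, M 0)%N (n, code u n.+1))
  (wt_base : forall n, 0 < wt (0%N :: mkseq M n.+1)).

Let invS1 n : n.+1%:R^-1 <= 1 :> R. Proof. by rewrite invf_le1// ler1n. Qed.

Let cell_code t := [set u | D u /\ mkseq (code u) (size t) = t].

Let cell_code_borel t : measurable (cell_code t).
Proof.
have [->|/wtP[]//] := eqVneq t [::].
by rewrite (_ : cell_code [::] = D)//; apply/seteqP; split=> u // [].
Qed.

(** There are countably many finite sequences, so a condition on a finite prefix, however irregular,
    defines a countable union of cylinders. *)
Lemma code_set_borel n (P : set (seq nat)) :
  measurable [set u | D u /\ P (mkseq (code u) n)].
Proof.
pose F k := if unpickle k is Some t then cell_code t else set0.
rewrite (_ : [set _ | _] = \bigcup_(k in [set k | exists t,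
    [/\ unpickle k = Some t, size t = n & P t]]) F k).
  apply: bigcup_measurable => k _; rewrite /F.
  by case: (unpickle k) => [t|]; [exact: cell_code_borel|exact: measurable0].
apply/seteqP; split=> u.
  move=> [Du Pu]; exists (pickle (mkseq (code u) n)).
    by exists (mkseq (code u) n); rewrite pickleK size_mkseq.
  by rewrite /F pickleK /cell_code/= size_mkseq.
move=> [k [t [kt tn Pt]]]; rewrite /F kt => -[Du ut]; split=> //.
by rewrite -tn ut.
Qed.

Lemma code0_finite n : (nu [set u | D u /\ (code u 0 <= n)%N] < +oo)%E.
Proof.
have mcode0 k : measurable [set u | D u /\ (code u 0 <= k)%N].
  have := code_set_borel 1 [set t | (nth 0 t 0 <= k)%N].
  by rewrite (_ : [set _ | _] = [set u | D u /\ (code u 0 <= k)%N]).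
elim: n => [|n IH].
  have [_ wE] := wtP (isT : [:: 0%N] != [::]).
  rewrite (_ : [set _ | _] = [set u | D u /\ mkseq (code u) 1 = [:: 0%N]]).
    by rewrite wE ltry.
  apply/seteqP; split=> u [Du].
    by rewrite leqn0 => /eqP u0; split=> //; rewrite /mkseq/= u0.
  by rewrite /mkseq/= => -[u0]; split=> //; rewrite u0.
have [mA wE] : measurable [set u | D u /\ mkseq (code u) 1 = [:: n.+1]] /\
    nu [set u | D u /\ mkseq (code u) 1 = [:: n.+1]] = (wt [:: n.+1])%:E.
  exact: wtP (isT : [:: n.+1] != [::]).
apply: (@le_lt_trans _ _ (nu ([set u | D u /\ (code u 0 <= n)%N] `|`
    [set u | D u /\ mkseq (code u) 1 = [:: n.+1]]))).
  apply: le_measure; rewrite ?inE//; first exact: measurableU.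
  move=> u [Du]; rewrite leq_eqVlt => /orP[/eqP u0|]; last by left.
  by right; split=> //; rewrite /mkseq/= u0.
apply: le_lt_trans (measureU2 _ _ _) _ => //.
by apply: lte_add_pinfty => //; have := ltry (wt [:: n.+1]); rewrite -wE.
Qed.

Let code_limit u : exists y : completion d, (D u -> forall n, (code u 0 <= n)%N ->
  mdist y (K n (code u n.+1)) <= n.+1%:R^-1) /\ (~ D u -> y = q).
Proof.
have [Du|nDu] := pselect (D u); last by exists q; split.
pose y n := K n (code u n.+1).
have ycauchy : cvg (y @ \oo).
  apply: cauchy_cvg; apply/cauchyP => e e0; have e30 : 0 < e / 3 by rewrite divr_gt0.
  have [N _ NP] := near_infty_natSinv_lt (PosNum e30).
  pose n0 := maxn N (code u 0); exists (y n0); exists n0 => // m /= n0m.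
  apply/in_ball; rewrite /y mdist_embed2.
  apply: (le_lt_trans (d_code Du (leq_maxr _ _) (leq_trans (leq_maxr _ _) n0m))).
  have /= := NP _ (leq_maxl N (code u 0)).
  have /= := NP _ (leq_trans (leq_maxl N (code u 0)) n0m).
  move: (n0.+1%:R^-1) (m.+1%:R^-1) => a b; lra.
exists (lim (y @ \oo)); split=> // _ n un; apply/ler_addgt0Pr => e e0.
have e20 : 0 < e / 2 by rewrite divr_gt0.
have /metricType_numDomainType.cvgrPdist_lt/(_ _ e20) [N1 _ N1P] := ycauchy.
have [N2 _ N2P] := near_infty_natSinv_lt (PosNum e20).
pose m := maxn (code u 0) (maxn N1 N2).
have um : (code u 0 <= m)%N by exact: leq_maxl.
have /= ym := N1P m (leq_trans (leq_maxl _ _) (leq_maxr _ _)).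
have /= mm := N2P m (leq_trans (leq_maxr _ _) (leq_maxr _ _)).
have := metric_triangle (lim (y @ \oo)) (y m) (K n (code u n.+1)).
have : mdist (y m) (K n (code u n.+1)) <= m.+1%:R^-1 + n.+1%:R^-1.
  by rewrite mdist_embed2; exact: d_code.
move: (m.+1%:R^-1) (n.+1%:R^-1) mm => a b; lra.
Qed.

Definition code_point u : completion d := sval (cid (code_limit u)).

Lemma code_pointP u n : D u -> (code u 0 <= n)%N ->
  mdist (code_point u) (K n (code u n.+1)) <= n.+1%:R^-1.
Proof. by move=> Du; exact: (svalP (cid (code_limit u))).1. Qed.

Lemma code_point_out u : ~ D u -> code_point u = q.
Proof. exact: (svalP (cid (code_limit u))).2. Qed.

(** For [u] in [D] the limit lies in the open set U exactly when, for some n at least the first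
    entry, the closed ball of radius 1/(n+1) about the net point of level n lies in U. This depends
    on n + 2 entries only. *)
Lemma code_point_borel :
  measurable_fun setT (code_point : measurableTypeR R -> borel (completion d)).
Proof.
apply: (@measurability _ _ _ (borel (completion d)) _ _ (@open (completion d))) => //.
move=> _ [U oU <-]; rewrite setTI.
rewrite (_ : _ @^-1` _ = (\bigcup_n [set u | D u /\
      ((code u 0 <= n)%N /\ forall y, mdist y (K n (code u n.+1)) <= n.+1%:R^-1 -> U y)]) `|`
    (~` D `&` [set _ | U q])).
  apply: measurableU.
    apply: bigcupT_measurable => n.
    have := code_set_borel n.+2 [set t | (nth 0 t 0 <= n)%N /\
      forall y, mdist y (K n (nth 0 t n.+1)) <= n.+1%:R^-1 -> U y].
    rewrite (_ : [set _ | _] = [set u | D u /\ ((code u 0 <= n)%N /\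
      forall y, mdist y (K n (code u n.+1)) <= n.+1%:R^-1 -> U y)])//.
    by apply: eq_set => u; rewrite /mkset !nth_mkseq.
  apply: measurableI; first exact: measurableC.
  have [Uq|nUq] := pselect (U q).
    by rewrite (_ : [set _ | _] = setT)//; apply/seteqP; split.
  by rewrite (_ : [set _ | _] = set0)//; apply/seteqP; split.
apply/seteqP; split=> u; last first.
  move=> [[n _ [Du [un +]]]|[nDu]] /=; last by rewrite code_point_out.
  by apply; exact: code_pointP.
move=> /= Uu; have [Du|nDu] := pselect (D u); last first.
  by right; split=> //=; rewrite -(code_point_out nDu).
left; have [e e0 eU] := (open_ballP U).1 oU _ Uu.
have e20 : 0 < e / 2 by rewrite divr_gt0.
have [N _ NP] := near_infty_natSinv_lt (PosNum e20).
have un := leq_maxl (code u 0) N; have Nn := leq_maxr (code u 0) N.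
exists (maxn (code u 0) N) => //; split=> //; split=> // y yK.
apply/eU/in_ball; have /= := NP _ Nn; have := code_pointP Du un.
have := metric_triangle (code_point u) (K (maxn (code u 0) N) (code u (maxn (code u 0) N).+1)) y.
move: yK; rewrite (metric_sym y); move: ((maxn (code u 0) N).+1%:R^-1) => a; lra.
Qed.

Definition limit_pmms : pmms R := PMMS (completion d)
  (measure_function_pushforward__canonical__measure_function_Measure
    nu code_point_borel) q.

Lemma pmeas_limitE (B : set (completion d)) :
  pmeas limit_pmms B = nu (code_point @^-1` B).
Proof. by []. Qed.

(** The summand 2 collects two errors of at most 1: from the limit point to its net point, and the
    one in [d_code_ge]. *)
Lemma code0_le u n : D u -> mdist q (code_point u) <= n%:R -> (code u 0 <= n.+2)%N.
Proof.
move=> Du qu; rewrite -(@ler_nat R).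
have := d_code_ge Du (leqnn _); have := code_pointP Du (leqnn _).
have := metric_triangle q (code_point u) (K (code u 0) (code u (code u 0).+1)).
rewrite mdist_embed2 -addn2 natrD; have := invS1 (code u 0).
move: ((code u 0).+1%:R^-1) qu => e; lra.
Qed.

Lemma limit_boundedly_finite : boundedly_finite (pmeas limit_pmms).
Proof.
move=> y r; rewrite pmeas_limitE.
pose n := Num.bound (mdist q y + `|r|).
have qyr : mdist q y + `|r| < n%:R.
  by apply: archi_boundP; rewrite addr_ge0// mdist_ge0.
have mD0 : measurable [set u | D u /\ (code u 0 <= n.+2)%N].
  have := code_set_borel 1 [set t | (nth 0 t 0 <= n.+2)%N].
  by rewrite (_ : [set _ | _] = [set u | D u /\ (code u 0 <= n.+2)%N]).
apply: (@le_lt_trans _ _ (nu ([set u | D u /\ (code u 0 <= n.+2)%N] `|` ~` D))).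
  apply: le_measure; rewrite ?inE//.
  - rewrite -[X in measurable X]setTI; apply: code_point_borel => //.
    exact: (ball_borel (X := completion d)).
  - by apply: measurableU => //; exact: measurableC.
  move=> u /in_ball yu; have [Du|] := pselect (D u); last by right.
  left; split=> //; apply: code0_le => //.
  have := metric_triangle q y (code_point u); have := ler_norm r; lra.
apply: le_lt_trans (measureU2 _ _ _) _ => //; first exact: measurableC.
by have := code0_finite n.+2; rewrite -[ltLHS]adde0 -nuD.
Qed.

(** All codes starting with 0, M 0, ..., M n have limit points within 1/(n+1) of [q], and this
    cylinder has positive measure. *)
Lemma limit_spt : spt (pmeas limit_pmms) q.
Proof.
move=> r r0; rewrite pmeas_limitE.
have [n _ /(_ n (leqnn n)) /= nr] := near_infty_natSinv_lt (PosNum r0).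
have [mA wE] : measurable (cell_code (0%N :: mkseq M n.+1)) /\
  nu (cell_code (0%N :: mkseq M n.+1)) = (wt (0%N :: mkseq M n.+1))%:E by exact: wtP.
apply: (@lt_le_trans _ _ (nu (cell_code (0%N :: mkseq M n.+1)))).
  by have := wt_base n; rewrite -lte_fin -wE.
apply: le_measure; rewrite ?inE//.
  rewrite -[X in measurable X]setTI; apply: code_point_borel => //.
  exact: (ball_borel (X := completion d)).
move=> u [Du]; rewrite -[size _]/(size (mkseq M n.+1)).+1 size_mkseq => ut.
have u0 : code u 0 = 0%N by rewrite -(nth_mkseq 0%N (code u) (ltn0Sn n.+1)) ut.
have un : code u n.+1 = M n.
  rewrite -(nth_mkseq 0%N (code u) (ltnSn n.+1)) ut.
  by rewrite -[LHS]/(nth 0%N (mkseq M n.+1) n) nth_mkseq.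
have := @code_pointP u n Du; rewrite u0 un => /(_ isT) uK.
apply/in_ball; apply: le_lt_trans (metric_triangle _ (K n (M n)) _) _.
rewrite mdist_embed2 d_base add0r metric_sym.
exact: le_lt_trans uK nr.
Qed.

Lemma integral_code_cvg (phi : completion d -> R) (C rho : R) :
  continuous phi -> (forall y, `|phi y| <= C) ->
  (forall y, rho <= mdist q y -> phi y = 0) ->
  (\int[nu]_(u in [set u | D u /\ (code u 0 <= n)%N])
     (phi (K n (code u n.+1)))%:E)%E @[n --> \oo]
  --> (\int[pmeas limit_pmms]_y (phi y)%:E)%E.
Proof.
move=> cphi phiC phi0.
(* The net point of level n is controlled only once n reaches the first entry of the code; for fixed
   [u] the value 0 is taken finitely often. *)
pose f n u : \bar R := if (code u 0 <= n)%N then (phi (K n (code u n.+1)))%:E else 0%E.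
(* A first entry above N puts the net point at distance at least N - 1 >= rho from [q], where [phi]
   vanishes; the added 1 absorbs 1/(n+1). *)
pose N := (Num.bound `|rho|).+1.
have rhoN : rho <= N%:R - 1.
  rewrite /N -natr1 addrK (le_trans (ler_norm _))// ltW//.
  exact: archi_boundP.
have C0 : 0 <= C by exact: le_trans (normr_ge0 _) (phiC q).
pose g u : \bar R := if (code u 0 <= N)%N then C%:E else 0%E.
have mcode0 k : measurable [set u | D u /\ (code u 0 <= k)%N].
  have := code_set_borel 1 [set t | (nth 0 t 0 <= k)%N].
  by rewrite (_ : [set _ | _] = [set u | D u /\ (code u 0 <= k)%N]).
have mf n : @measurable_fun _ _ (measurableTypeR R) (\bar R) D (f n).
  move=> _ Z mZ; rewrite (_ : _ `&` _ = [set u | D u /\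
     Z (if (nth 0 (mkseq (code u) n.+2) 0 <= n)%N
        then (phi (K n (nth 0 (mkseq (code u) n.+2) n.+1)))%:E else 0%E)]).
    exact: (code_set_borel n.+2 [set t | Z (if (nth 0 t 0 <= n)%N
       then (phi (K n (nth 0 t n.+1)))%:E else 0%E)]).
  by apply: eq_set => u; rewrite !nth_mkseq.
have gE u : g u = ((fun=> C%:E) \_ [set u | (code u 0 <= N)%N]) u.
  by rewrite /g patchE; case: ifPn => u0; [rewrite mem_set|rewrite memNset//; exact/negP].
have mg : @measurable_fun _ _ (measurableTypeR R) (\bar R) D g.
  move=> _ Z mZ; rewrite (_ : _ `&` _ = [set u | D u /\
     Z (if (nth 0 (mkseq (code u) 1) 0 <= N)%N then C%:E else 0%E)]).
    exact: (code_set_borel 1 [set t | Z (if (nth 0 t 0 <= N)%N then C%:E else 0%E)]).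
  by apply: eq_set => u.
have ig : nu.-integrable D g.
  apply/integrableP; split=> //.
  rewrite (eq_integral ((fun=> C%:E) \_ [set u | (code u 0 <= N)%N])); last first.
    by move=> u _ /=; rewrite -gE /g; case: ifP => _ /=; rewrite ?normr0 ?ger0_norm.
  rewrite -integral_mkcondr integral_cst//; last exact: mcode0.
  by apply: lte_mul_pinfty => //; exact: code0_finite.
have fg n u : D u -> (`|f n u| <= g u)%E.
  move=> Du; rewrite /f /g; case: ifPn => [un|_]; last first.
    by rewrite abse0; case: ifP => // _; rewrite lee_fin.
  case: ifPn => [_|]; first by rewrite lee_fin.
  rewrite -ltnNge => Nu; rewrite phi0 ?abse0// mdist_embed2.
  apply: le_trans (d_code_ge Du un); apply: (le_trans rhoN).
  by rewrite lerB// ler_nat ltnW.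
have fcvg u : D u -> f n u @[n --> \oo] --> (phi (code_point u))%:E.
  move=> Du; apply: (@cvg_trans _ ((fun n => (phi (K n (code u n.+1)))%:E) @ \oo)).
    apply: near_eq_cvg; near=> n; rewrite /f ifT//.
    by near: n; exact: nbhs_infty_ge.
  apply: cvg_EFin; first by apply: nearW.
  apply: (@continuous_cvg _ _ _ _ _ _ phi); first exact: cphi.
  apply/metricType_numDomainType.cvgrPdist_lt => e e0.
  have [k _ kP] := near_infty_natSinv_lt (PosNum e0).
  near=> n; apply: (le_lt_trans (code_pointP Du _)).
    by near: n; exact: nbhs_infty_ge.
  by apply: kP => /=; near: n; exact: nbhs_infty_ge.
have := @dominated_cvg _ _ _ nu D D_borel f (fun u => (phi (code_point u))%:E) g mf fcvg.
have gfin u : D u -> g u \is a fin_num by move=> _; rewrite /g; case: ifP.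
move=> /(_ gfin ig fg).
have -> : (fun n => \int[nu]_(u in D) f n u)%E = (fun n =>
  \int[nu]_(u in [set u | D u /\ (code u 0 <= n)%N]) (phi (K n (code u n.+1)))%:E)%E.
  apply/funext => n.
  rewrite (_ : [set u | _] = D `&` [set u | (code u 0 <= n)%N])//.
  rewrite [RHS]integral_mkcondr; apply: eq_integral => u _.
  by rewrite patchE /f; case: ifPn => u0; [rewrite mem_set|rewrite memNset//; exact/negP].
suff -> : (\int[nu]_(u in D) (phi (code_point u))%:E)%E =
  (\int[pmeas limit_pmms]_y (phi y)%:E)%E by [].
pose psi u := (phi (code_point u))%:E.
have mphi : @measurable_fun _ _ (borel (completion d)) (\bar R) setT (EFin \o phi).
  by apply/measurable_EFinP; exact: continuous_borel.
have mpsi : @measurable_fun _ _ (measurableTypeR R) (\bar R) setT psi.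
  exact: measurableT_comp mphi code_point_borel.
have mDC : measurable (~` D) by exact: measurableC.
have TDC : setT `\` ~` D = D by rewrite setTD setCK.
have ipsi : nu.-integrable setT psi.
  have [ipsi _ _] : [/\ nu.-integrable D psi, True & True].
    have mD : @measurable_fun _ _ (measurableTypeR R) (\bar R) D psi.
      exact: measurable_funS mpsi.
    have fcvg' : \forall u \ae nu, D u -> f n u @[n --> \oo] --> psi u.
      by apply: aeW => u; exact: fcvg.
    have fg' : \forall u \ae nu, forall n, D u -> (`|f n u| <= g u)%E.
      by apply: aeW => u n; exact: fg.
    by have [] := dominated_convergence D_borel mf mD fcvg' ig fg'.
  apply/integrableP; split=> //.
  have /integrableP[_] := ipsi; rewrite -{1}TDC -ge0_negligible_integral//.
  exact: measurableT_comp.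
rewrite (integral_pushforward code_point_borel mphi)// preimage_setT.
by rewrite (negligible_integral mDC _ ipsi nuD)// TDC.
Unshelve. all: by end_near. Qed.

End limit_measure.

(** * Integrals of functions of a finite code *)

Section code_integral.
Context (n : nat) (M : nat -> nat).

(** A common strict bound for a first entry at most n and for net indices at most [M l], so that the
    codes of length n + 2 form a finite type. *)
Let bound := (n + \sum_(l < n.+1) M l).+1.

Definition short_code := {ffun 'I_n.+2 -> 'I_bound}.

Definition code_seq (g : short_code) : seq nat := mkseq (fun k => nat_of_ord (g (inord k))) n.+2.

Lemma size_code_seq g : size (code_seq g) = n.+2.
Proof. by rewrite size_mkseq. Qed.

Lemma nth_code_seq g (k : 'I_n.+2) : nth 0%N (code_seq g) k = g k.
Proof. by rewrite nth_mkseq// inord_val. Qed.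

Lemma code_seq_inj : injective code_seq.
Proof.
by move=> g h gh; apply/ffunP => k; apply: ord_inj; rewrite -!nth_code_seq gh.
Qed.

Lemma code_seq_surj (f : nat -> nat) : (f 0 <= n)%N ->
  (forall l, (l <= n)%N -> (f l.+1 <= M l)%N) ->
  exists2 g : short_code, (g ord0 <= n)%N & mkseq f n.+2 = code_seq g.
Proof.
move=> f0 fM; have fb k : (k < n.+2)%N -> (f k < bound)%N.
  case: k => [|k] kn; first by rewrite ltnS (leq_trans f0)// leq_addr.
  rewrite ltnS (leq_trans (fM _ kn))// (leq_trans _ (leq_addl _ _))//.
  by rewrite (bigD1 (Ordinal (kn : (k < n.+1)%N)))//= leq_addr.
exists [ffun k : 'I_n.+2 => inord (f k)]; first by rewrite ffunE inordK ?fb.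
apply: (@eq_from_nth _ 0%N); rewrite !size_mkseq// => k kn.
by rewrite !nth_mkseq// ffunE !inordK// ?inordK// fb.
Qed.

(** The integrand is constant on code cells. Stated for abstract codes, the formula applies both to
    the spaces [X i] and to [nu], reducing the comparison of integrals to that of cell masses. *)
Lemma integral_code {d} {T : measurableType d} {R : realType}
    (mu : {measure set T -> \bar R}) (E : set T) (cd : T -> nat -> nat)
    (a : nat -> R) :
  (forall x l, E x -> (cd x l.+1 <= M l)%N) ->
  (forall t, measurable [set x | E x /\ mkseq (cd x) (size t) = t]) ->
  (\int[mu]_(x in [set x | E x /\ (cd x 0 <= n)%N]) (a (cd x n.+1))%:E =
   \sum_(g : short_code | (g ord0 <= n)%N) (a (g ord_max))%:E *
     mu [set x | E x /\ mkseq (cd x) n.+2 = code_seq g])%E.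
Proof.
move=> cdM mcd; pose F (g : short_code) := [set x | E x /\ mkseq (cd x) n.+2 = code_seq g].
have mF g : measurable (F g) by have := mcd (code_seq g); rewrite size_code_seq.
have Fa g x : F g x -> (a (cd x n.+1))%:E = (a (g ord_max))%:E.
  move=> [Ex xg]; rewrite -(nth_code_seq g ord_max) -xg nth_mkseq//.
have F0 g x : F g x -> cd x 0 = g ord0.
  by move=> [Ex xg]; rewrite -(nth_code_seq g ord0) -xg nth_mkseq.
pose s := enum [pred g : short_code | (g ord0 <= n)%N].
have sP g : (g \in s) = (g ord0 <= n)%N by rewrite mem_enum.
have BE : [set x | E x /\ (cd x 0 <= n)%N] = \big[setU/set0]_(g <- s) F g.
  rewrite -bigcup_seq; apply/seteqP; split=> x.
    move=> [Ex x0]; have [g g0 xg] := code_seq_surj x0 (fun l _ => cdM x l Ex).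
    by exists g => //=; rewrite sP.
  move=> [g /=]; rewrite sP => g0 gx; split; first by case: gx.
  by rewrite (F0 _ _ gx).
have tF : trivIset [set` s] F.
  apply/trivIsetP => g h _ _ gh; rewrite -subset0 => x [[_ xg] [_ xh]].
  by move: gh; rewrite (code_seq_inj (etrans (esym xg) xh)) eqxx.
have mB : measurable_fun (\big[setU/set0]_(g <- s) F g) (EFin \o (fun x => a (cd x n.+1))).
  move=> _ Z mZ; rewrite (_ : _ `&` _ =
      \big[setU/set0]_(g <- [seq g : short_code <- s | `[< Z (a (g ord_max))%:E >]]) F g).
    by apply: bigsetU_measurable => g _; exact: mF.
  rewrite -!bigcup_seq; apply/seteqP; split=> x.
    move=> [[g /= gs gx] Zx]; exists g => //=.
    by rewrite mem_filter gs andbT; apply/asboolP; rewrite -(Fa _ _ gx).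
  move=> [g /=]; rewrite mem_filter => /andP[/asboolP Zg gs] gx.
  by split; [exists g|rewrite /= (Fa _ _ gx)].
rewrite BE (integral_bigsetU_EFin mu mF (enum_uniq _) tF mB).
rewrite big_enum/=; apply: eq_bigr => g _.
rewrite (eq_integral (fun=> (a (g ord_max))%:E)); last first.
  by move=> x; rewrite inE; exact: Fa.
by rewrite integral_cst.
Qed.

End code_integral.

(** * Compactness theorem *)

Section compactness.
Context {R : realType} (omega : set_system nat) {UF : UltraFilter omega}.
Variables (X : nat -> pmms R) (A : forall i, set (X i)).
Arguments A : clear implicits.
Hypothesis core : precompact_core omega A.
Variables (M : nat -> nat) (z : nat -> nat -> forall i, X i).
Arguments z : clear implicits.
Local Notation p i := (basept (X i)).
Hypotheses (zA : forall n l i, A i (z n l i))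
  (z_le : forall n l i, mdist (p i) (z n l i) <= n%:R + 2)
  (z_base : forall n l i, (M n <= l)%N -> z n l i = p i)
  (z_net : forall n, omega [set i | forall x, A i x -> ball (p i) n.+1%:R x ->
      exists2 l, (l < M n)%N & ball (z n l i) n.+1%:R^-1 x]).

Let d : pseudometric R (nat * nat)%type := net_pseudometric z_le.
Let wt : seq nat -> R := cell_weight omega M z.
Local Notation net_index := (@net_index R X M z).
Local Notation net_code := (@net_code R X M z).
Local Notation K n l := (completion_embed d (n, l)%N).

Variables (nu : {measure set (measurableTypeR R) -> \bar R})
  (D : set (measurableTypeR R)) (code : measurableTypeR R -> nat -> nat).
Hypotheses (D_borel : measurable D) (nuD : nu (~` D) = 0%E)
  (code_gt0 : forall u n, D u -> 0 < wt (mkseq (code u) n.+1))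
  (wtP : forall t, t != [::] ->
    let B := [set u | D u /\ mkseq (code u) (size t) = t] in
    measurable B /\ nu B = (wt t)%:E).

Let omegaS (P Q : set nat) : P `<=` Q -> omega P -> omega Q.
Proof. by move=> PQ oP; apply: (@filterS _ omega _ _ _ PQ oP). Qed.

Let omegaI (P Q : set nat) : omega P -> omega Q -> omega (P `&` Q).
Proof. exact: filterI. Qed.

Let omega_ex (P : set nat) : omega P -> exists i, P i.
Proof. exact: filter_ex. Qed.

Let near_index n : omega [set i | forall x, A i x -> ball (p i) n.+1%:R x ->
  mdist (z n (net_index n x) i) x < n.+1%:R^-1].
Proof. exact: mdist_net_index. Qed.

Let near_dist a b e : 0 < e -> omega [set i |
  `|d a b - mdist (z a.1 a.2 i) (z b.1 b.2 i)| < e].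
Proof. exact: net_pseudometricP. Qed.

(** The bridge from codes to spaces: a prefix of positive weight is realised by a point of [A i] for
    omega-a.e. i. Inequalities for limit distances then follow from triangle inequalities through
    this point. *)
Let code_visit u n : D u -> omega [set i | exists x : X i, A i x /\
  forall k, (k <= n)%N -> net_code x k = code u k].
Proof.
move=> Du; have t0 : mkseq (code u) n.+1 != [::] by [].
have H : omega [set i | exists x, A i x /\ cell M z i (mkseq (code u) n.+1) x].
  by apply: (core_cell_nonempty core t0); exact: code_gt0.
apply: omegaS H => i [x [Ax xu]]; exists x; split=> // k kn.
have xu' : mkseq (net_code x) n.+1 = mkseq (code u) n.+1.
  by move: xu; rewrite /cell /mkset size_mkseq.
by rewrite -(nth_mkseq 0%N (net_code x) (kn : (k < n.+1)%N)) xu' nth_mkseq.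
Qed.

Let code_le u n : D u -> (code u n.+1 <= M n)%N.
Proof.
move=> Du; have [i [x [Ax xu]]] := omega_ex (code_visit n.+1 Du).
by rewrite -xu//; exact: net_index_le.
Qed.

Let code_visit_near u n : D u -> (code u 0 <= n)%N -> omega [set i | forall x, A i x ->
  (forall k, (k <= n.+1)%N -> net_code x k = code u k) ->
   mdist (z n (code u n.+1) i) x < n.+1%:R^-1].
Proof.
move=> Du un; apply: omegaS (near_index n) => i /= H x Ax xu.
rewrite -xu//; apply: H => //; apply/(net_code0P M z).
by rewrite xu.
Qed.

Let d_code u n m : D u -> (code u 0 <= n)%N -> (code u 0 <= m)%N ->
  d (n, code u n.+1) (m, code u m.+1) <= n.+1%:R^-1 + m.+1%:R^-1.
Proof.
move=> Du un um; apply: net_pseudometric_le.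
have H := omegaI (code_visit (maxn n m).+1 Du)
  (omegaI (code_visit_near Du un) (code_visit_near Du um)).
apply: omegaS H => i [[x [Ax xu]] [xn xm]] /=.
apply: (le_trans (metric_triangle _ x _)); apply: lerD.
  apply/ltW/xn => // k kn; apply: xu.
  by rewrite (leq_trans kn)// ltnS leq_maxl.
rewrite metric_sym; apply/ltW/xm => // k km; apply: xu.
by rewrite (leq_trans km)// ltnS leq_maxr.
Qed.

Let d_code_ge u n : D u -> (code u 0 <= n)%N ->
  (code u 0)%:R - n.+1%:R^-1 <= d (0, M 0)%N (n, code u n.+1).
Proof.
move=> Du un; apply: net_pseudometric_ge.
have H := omegaI (code_visit n.+1 Du) (code_visit_near Du un).
apply: omegaS H => i [[x [Ax xu]] xn] /=; rewrite z_base//.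
rewrite lerBlDr; apply: (@le_trans _ _ (mdist (p i) x)).
  by rewrite -xu//= truncn_le mdist_ge0.
apply: (le_trans (metric_triangle _ (z n (code u n.+1) i) _)).
by rewrite lerD2l ltW// xn.
Qed.

Let d_base n : d (0, M 0)%N (n, M n) = 0.
Proof. exact: net_pseudometric_base. Qed.

Let wt_base n : 0 < wt (0%N :: mkseq M n.+1).
Proof. exact: (base_cell_weight core). Qed.

Let Y := limit_pmms M D_borel wtP d_code.

Let cell_code_borel t : measurable [set u | D u /\ mkseq (code u) (size t) = t].
Proof.
have := code_set_borel D_borel wtP (size t) [set t].
by rewrite (_ : [set _ | _] = [set u | D u /\ mkseq (code u) (size t) = t]).
Qed.

(** All that level n requires of an index i. Each condition holds for omega-a.e. i and they are
    finitely many. The bound l <= M n is not strict, in order to include the label of the base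
    point. *)
Let good n : set nat := [set i | [/\
  forall l l', (l <= M n)%N -> (l' <= M n)%N ->
    `|d (n, l) (n, l') - mdist (z n l i) (z n l' i)| < n.+1%:R^-1,
  forall x, A i x -> ball (p i) n.+1%:R x -> mdist (z n (net_index n x) i) x < n.+1%:R^-1,
  (pmeas (X i) (ball (p i) n.+1%:R `\` A i) <= n.+1%:R^-1%:E)%E,
  (pmeas (X i) (ball (p i) n.+1%:R) < +oo)%E &
  \sum_(g : short_code n M) `|wt (code_seq g) - fine (pmeas (X i) (cell M z i (code_seq g)))|
     <= n.+1%:R^-1]].

Let omega_good n : omega (good n).
Proof.
have n0 : 0 < n.+1%:R^-1 :> R by rewrite invr_gt0.
have near_net : omega [set i | forall ll : 'I_(M n).+1 * 'I_(M n).+1,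
    `|d (n, nat_of_ord ll.1) (n, nat_of_ord ll.2) - mdist (z n ll.1 i) (z n ll.2 i)| < n.+1%:R^-1].
  apply: filter_forall => ll.
  exact: (near_dist (n, nat_of_ord ll.1) (n, nat_of_ord ll.2) n0).
pose e : R := n.+1%:R^-1 / #|short_code n M|.+1%:R.
have e0 : 0 < e by rewrite divr_gt0.
have near_wt : omega [set i | forall g : short_code n M,
    `|wt (code_seq g) - fine (pmeas (X i) (cell M z i (code_seq g)))| < e].
  apply: filter_forall => g.
  have g0 : code_seq g != [::] by rewrite -size_eq0 size_code_seq.
  exact: (cell_weightP core M z g0 e0).
have near_fin : omega [set i | (pmeas (X i) (ball (p i) n.+1%:R) < +oo)%E].
  exact: (finite_mass core).
have H := omegaI near_net (omegaI (near_index n)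
  (omegaI (core_full core n.+1 n0) (omegaI near_fin near_wt))).
apply: omegaS H => i /= [H1 [H2 [H3 [H4 H5]]]]; split=> //.
  move=> l l' lM l'M.
  have := H1 (Ordinal (lM : (l < (M n).+1)%N), Ordinal (l'M : (l' < (M n).+1)%N)).
  by [].
apply: (@le_trans _ _ (\sum_(g : short_code n M) e)); first by apply: ler_sum => g _; exact: ltW.
rewrite sumr_const -[leLHS]mulr_natl /e mulrCA ger_pMr// ler_pdivrMr// mul1r.
by rewrite ler_nat.
Qed.

Let psi n i (x : X i) : Y := K n (net_index n x).

Let psi_base n i : psi n (p i) = basept Y.
Proof.
apply: mdist_positivity; rewrite /psi net_index_base// metric_sym mdist_embed2.
exact: d_base.
Qed.

Let psi_borel n i (B : set (X i)) : measurable (B : set (borel (X i))) ->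
  measurable_fun (B : set (borel (X i))) (@psi n i : borel (X i) -> borel Y).
Proof.
move=> mB _ Z _; apply: (@measurableI _ (borel (X i))) => //.
rewrite (_ : _ @^-1` _ = \bigcup_(j in [set j | Z (K n j)]) [set x | net_index n x = j]).
  by apply: (@bigcup_measurable _ (borel (X i))) => j _; exact: net_index_borel.
apply/seteqP; split=> x /=; first by exists (net_index n x).
by move=> [j /= Zj xj]; rewrite /psi xj.
Qed.

(** With a = 1/(n+1), the distortion on the core is at most 3a: two net errors and one label error.
    Points of the limit ball are reached up to less than 4a, and 5a leaves the margin that keeps the
    auxiliary points inside the ball of radius n + 1. *)
Let psi_approx n i : (5 <= n)%N -> good n i ->
  weak_approximation n.+1%:R (5 / n.+1%:R) (@psi n i : X i -> Y).
Proof.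
move=> n5 [near_net near_idx full _ _].
pose a : R := n.+1%:R^-1.
have a0 : 0 < a by rewrite invr_gt0.
have n6 : 6 <= n.+1%:R :> R by rewrite ler_nat.
have na : n.+1%:R * a = 1 by rewrite mulfV.
have a6 : 6 * a <= 1 by rewrite -[leRHS]na ler_pM2r.
have mball : measurable (ball (p i) n.+1%:R : set (borel (X i))) by exact: ball_borel.
have net_near x y : A i x -> A i y -> ball (p i) n.+1%:R x -> ball (p i) n.+1%:R y ->
    `|mdist x y - mdist (psi n x) (psi n y)| <= 3 * a.
  move=> Ax Ay px py; rewrite mdist_embed2.
  have := near_net _ _ (net_index_le M z n x) (net_index_le M z n y).
  have := near_idx _ Ax px; have := near_idx _ Ay py.
  set zx := z n (net_index n x) i; set zy := z n (net_index n y) i; rewrite -/a.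
  have := metric_triangle x zx y; have := metric_triangle zx zy y.
  have := metric_triangle zx x zy; have := metric_triangle x y zy.
  rewrite (metric_sym x zx) (metric_sym y zy) ltr_norml ler_norml.
  set u := mdist x y; set v := mdist zx zy; set w := d _ _.
  move: (mdist zx x) (mdist zy y) (mdist zx y) (mdist x zy) => b c e f.
  by move=> ? ? ? ? ? ? /andP[? ?]; lra.
split.
- by rewrite divr_gt0//=; rewrite -/a; lra.
- exact: psi_borel.
- exact: psi_base.
exists (A i `&` ball (p i) n.+1%:R); split.
- apply: (@measurableI _ (borel (X i))) => //; exact: core_borel core i.
- by move=> x [].
- by split; [exact: core_base core i|apply/in_ball; rewrite mdistxx].
- move=> x y [Ax px] [Ay py]; apply: (le_trans (net_near x y Ax Ay px py)).
  by rewrite -/a; lra.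
split.
  rewrite setDIr setDv setU0; apply: (le_trans full).
  by rewrite lee_fin -/a; lra.
rewrite (_ : _ `\` _ = set0); first by rewrite measure0 lee_fin -/a; lra.
rewrite -subset0 => y [/in_ball qy]; apply.
have a40 : 0 < a / 4 by rewrite divr_gt0.
(* The label close to [y] may have a level n' about which [good n i] says nothing. An auxiliary
   index i', accurate for the distances from this label to the base and to level n, is used to
   exchange it for a label (n, l); [None] denotes the base label. *)
have [[n' l'] yl'] := dense_embed y a40.
have cover : omega [set i' | forall ll : option 'I_(M n).+1,
   `|d (n', l') (if ll is Some l then (n, nat_of_ord l) else (0, M 0))%N -
     mdist (z n' l' i') (if ll is Some l then z n l i' else z 0 (M 0) i')| < a / 4].
  apply: filter_forall => -[l|].
    exact: (near_dist (n', l') (n, nat_of_ord l) a40).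
  exact: (near_dist (n', l') (0, M 0)%N a40).
have [i' [near_i' idx_i']] := omega_ex (omegaI cover (near_index n)).
have base_i' : `|d (n', l') (0, M 0)%N - mdist (z n' l' i') (p i')| < a / 4.
  by rewrite -[p i'](z_base i' (leqnn (M 0))); exact: near_i' None.
pose x' := z n' l' i'.
have qd : d (n', l') (0, M 0)%N <= mdist (basept Y) y + mdist y (K n' l').
  by rewrite pdist_sym -mdist_embed2; exact: metric_triangle.
have px' : ball (p i') n.+1%:R x'.
  apply/in_ball; rewrite metric_sym; move: base_i' qd qy yl'; rewrite ltr_norml -/a.
  rewrite /x'; move: (mdist (z n' l' i') (p i')) (mdist (basept Y) y) (mdist y (K n' l')) => b c e.
  by move=> /andP[? ?]; lra.
have := idx_i' _ (zA n' l' i') px'; rewrite -/x' -/a.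
set l := net_index n x' => lx'.
have lM : (l < (M n).+1)%N by exact: net_index_le.
have dl : `|d (n', l') (n, l) - mdist (z n l i') x'| < a / 4.
  by rewrite (metric_sym _ x'); exact: near_i' (Some (Ordinal lM)).
have yl : mdist y (K n l) < 2 * a.
  have := metric_triangle y (K n' l') (K n l); rewrite [mdist (K n' l') _]mdist_embed2.
  move: dl yl' lx'; rewrite ltr_norml.
  move: (mdist (z n l i') x') (mdist y (K n' l')) (mdist y (K n l)) => b c e.
  by move=> /andP[? ?]; lra.
(* Back in [X i], the point with label (n, l) need not have net index l, but its image is within 2a
   of that label, which is itself within 2a of [y]. *)
pose x := z n l i.
have near_base := near_net (M n) l (leqnn _) (lM : (l <= M n)%N).
rewrite [z n (M n) i]z_base// -/x -/a in near_base.
have qK : d (n, M n) (n, l) <= mdist (basept Y) y + mdist y (K n l).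
  rewrite -mdist_embed2.
  have -> : K n (M n) = basept Y by rewrite -(psi_base n i) /psi net_index_base.
  exact: metric_triangle.
have px : ball (p i) n.+1%:R x.
  apply/in_ball; move: near_base qK qy yl; rewrite ltr_norml -/a.
  move: (mdist (p i) x) (mdist (basept Y) y) (mdist y (K n l)) => b c e.
  by move=> /andP[? ?]; lra.
have Ax : A i x := zA n l i.
have idx_x := near_idx _ Ax px.
have := near_net _ _ (net_index_le M z n x) (lM : (l <= M n)%N).
rewrite -/x -/a => dx.
have psix : mdist (psi n x) (K n l) < 2 * a.
  rewrite mdist_embed2; move: idx_x dx; rewrite ltr_norml -/a.
  move: (mdist (z n (net_index n x) i) x) => b.
  by move=> ? /andP[? ?]; lra.
apply: (@le_lt_trans _ _ (mdist y (psi n x))%:E).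
  by apply: ereal_inf_lbound; exists (psi n x) => //; exists x.
rewrite lte_fin -/a; have := metric_triangle y (K n l) (psi n x).
rewrite (metric_sym (K n l)); move: (mdist y (psi n x)) (mdist y (K n l)) (mdist (psi n x) _) yl psix => b c e.
by lra.
Qed.

(** Both integrals are sums over the same short codes with the same values of [phi]; only the
    weights differ, by at most 1/(n+1) in total. *)
Let psi_integral n i (phi : Y -> R) C : good n i -> (forall y, `|phi y| <= C) ->
  exists2 e : R, `|e| <= C * n.+1%:R^-1 &
  (\int[pmeas (X i)]_(x in ball (p i) n.+1%:R) (phi (psi n x))%:E =
   \int[nu]_(u in [set u | D u /\ (code u 0 <= n)%N]) (phi (K n (code u n.+1)))%:E
   + e%:E)%E.
Proof.
move=> [_ _ _ fin_ball near_wt] phiC.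
pose a l := phi (K n l).
have -> : (\int[nu]_(u in [set u | D u /\ (code u 0 <= n)%N]) (phi (K n (code u n.+1)))%:E =
    (\sum_(g : short_code n M | (g ord0 <= n)%N) a (g ord_max) * wt (code_seq g))%:E)%E.
  rewrite (integral_code n nu a (fun u l => @code_le u l) cell_code_borel).
  rewrite -sumEFin; apply: eq_bigr => g _; rewrite EFinM.
  have g0 : code_seq g != [::] by rewrite -size_eq0 size_code_seq.
  have [_] := wtP g0; rewrite size_code_seq => wE.
  by congr (_ * _)%E; rewrite -wE.
(* Radius n + 1 is chosen so that the ball is exactly a union of cells: the integer part of the
   distance is at most n. *)
have BE : (ball (p i) n.+1%:R : set (X i)) = [set x | setT x /\ (net_code x 0 <= n)%N].
  apply/seteqP; split=> x.
    by move=> /(net_code0P M z) ?; split.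
  by move=> [_ ?]; apply/(net_code0P M z).
have cellE t : [set x : X i | setT x /\ mkseq (net_code x) (size t) = t] = cell M z i t.
  by apply/seteqP; split=> x // [].
have -> : (\int[pmeas (X i)]_(x in ball (p i) n.+1%:R) (phi (psi n x))%:E =
    (\sum_(g : short_code n M | (g ord0 <= n)%N)
       a (g ord_max) * fine (pmeas (X i) (cell M z i (code_seq g))))%:E)%E.
  rewrite BE.
  have := @integral_code n M _ (borel (X i)) R (pmeas (X i)) setT (@net_code i) a.
  move=> ->; last 2 first.
  - by move=> x l _; exact: net_index_le.
  - by move=> t; rewrite cellE; exact: cell_borel.
  rewrite -sumEFin; apply: eq_bigr => g g0; rewrite EFinM.
  have := cellE (code_seq g); rewrite size_code_seq => ->.
  rewrite fineK// ge0_fin_numE// (le_lt_trans _ fin_ball)//.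
  apply: le_mball; [exact: cell_borel|exact: ball_borel|].
  move=> x; rewrite /cell /mkset size_code_seq => xg; apply/(net_code0P M z).
  by rewrite -(nth_mkseq 0%N (net_code x) (ltn0Sn n.+1)) xg (nth_code_seq g ord0).
exists (\sum_(g : short_code n M | (g ord0 <= n)%N) a (g ord_max) *
    (fine (pmeas (X i) (cell M z i (code_seq g))) - wt (code_seq g))).
  apply: (le_trans (ler_norm_sum _ _ _)).
  have C0 : 0 <= C by exact: le_trans (normr_ge0 _) (phiC (K 0 0)%N).
  apply: (le_trans _ (ler_wpM2l C0 near_wt)); rewrite mulr_sumr.
  rewrite [leRHS](bigID (fun g : short_code n M => (g ord0 <= n)%N))/=.
  rewrite -[leLHS]addr0; apply: lerD.
    apply: ler_sum => g _; rewrite normrM distrC; apply: ler_wpM2r => //.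
    exact: phiC.
  by apply: sumr_ge0 => g _; rewrite mulr_ge0.
by rewrite -EFinD -big_split/=; congr EFin; apply: eq_bigr => g _; rewrite mulrBr subrKC.
Qed.

Hypothesis omega_infinite : forall n, omega [set i | (n <= i)%N].

Lemma precompact_limit : exists (Y : pmms R) (k : nat -> nat),
  [/\ boundedly_finite (pmeas Y), spt (pmeas Y) (basept Y),
    forall n, (k n < k n.+1)%N & wpmGH_cvg (fun n => X (k n)) Y].
Proof.
have next n N : exists i, good n i /\ (N <= i)%N.
  exact: omega_ex (omegaI (omega_good n) (omega_infinite N)).
have nextn nN : exists i, good nN.1 i /\ (nN.2 <= i)%N := next nN.1 nN.2.
have [nxt nxtP] := choice nextn.
(* The shift by 5 meets the assumption of [psi_approx]; searching from (k n').+1 on makes the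
   sequence strictly increasing. *)
pose k := fix k n := nxt (n + 5, if n is n'.+1 then (k n').+1 else 0)%N.
have k_good n : good (n + 5) (k n) by case: n => [|n]; [have [] := nxtP (0 + 5, 0)%N|have [] := nxtP (n.+1 + 5, (k n).+1)%N].
exists Y, k; split.
- exact: (limit_boundedly_finite (D_borel := D_borel) nuD (wtP := wtP) (d_code := d_code) d_code_ge).
- exact: (limit_spt D_borel wtP d_base d_code wt_base).
- by move=> n; have [_] := nxtP (n.+1 + 5, (k n).+1)%N.
exists (fun n => (n + 5).+1%:R), (fun n => 5 / (n + 5).+1%:R),
  (fun n => @psi (n + 5) (k n)); split.
- split.
    by move=> a b ab; rewrite ler_nat ltnS leq_add2r.
  apply/cvgryPge => c; near=> n.
  apply: (@le_trans _ _ n%:R); last by rewrite ler_nat -addnS leq_addr.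
  by near: n; exact: nbhs_infty_ger.
- split.
    by move=> a b ab; rewrite ler_pM2l// lef_pV2 ?posrE// ler_nat ltnS leq_add2r.
  rewrite -(mulr0 5); apply: cvgM; first exact: cvg_cst.
  apply/cvgrPdist_lt => e e0; near=> n.
  rewrite sub0r normrN gtr0_norm ?invr_gt0//.
  apply: (@le_lt_trans _ _ n.+1%:R^-1).
    by rewrite lef_pV2 ?posrE// ler_nat ltnS leq_addr.
  by near: n; exact: (near_infty_natSinv_lt (PosNum e0)).
- by move=> n; apply: psi_approx; [rewrite addnC leq_addr|exact: k_good].
move=> phi cphi [C phiC] [y0 [r0 supp]].
have phi0 y : mdist (basept Y) y0 + `|r0| <= mdist (basept Y) y -> phi y = 0.
  move=> far; apply/eqP/negPn/negP => phiy.
  have /in_ball := supp y (@subset_closure _ [set y | phi y != 0] y phiy).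
  by have := metric_triangle (basept Y) y0 y; have := ler_norm r0; lra.
have lim := integral_code_cvg (D_borel := D_borel) nuD (wtP := wtP) (d_code := d_code) d_code_ge cphi phiC phi0.
have : forall n, exists e : R, `|e| <= C * (n + 5).+1%:R^-1 /\
  (\int[pmeas (X (k n))]_(x in ball (p (k n)) (n + 5).+1%:R) (phi (psi (n + 5) x))%:E =
   \int[nu]_(u in [set u | D u /\ (code u 0 <= n + 5)%N]) (phi (K (n + 5) (code u (n + 5).+1)))%:E
   + e%:E)%E.
  by move=> n; have [e ? ?] := psi_integral (k_good n) phiC; exists e.
move=> /choice[e eP].
rewrite (_ : (fun n => _) = (fun n =>
   \int[nu]_(u in [set u | D u /\ (code u 0 <= n + 5)%N]) (phi (K (n + 5) (code u (n + 5).+1)))%:E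
   + (e n)%:E)%E); last by apply/funext => n; have [_ ->] := eP n.
rewrite -[X in _ --> X]adde0; apply: cvgeD => //.
- by rewrite fin_num_adde_defl.
- by have := lim; rewrite -(cvg_shiftn 5).
apply: cvg_EFin; first by apply: nearW.
apply/cvgrPdist_lt => b b0; rewrite /=.
have C0 : 0 <= C by exact: le_trans (normr_ge0 _) (phiC (basept Y)).
have bC0 : 0 < b / (C + 1) by rewrite divr_gt0// ltr_wpDl.
near=> n; have [en _] := eP n; rewrite sub0r normrN; apply: (le_lt_trans en).
apply: (@le_lt_trans _ _ ((C + 1) * (n + 5).+1%:R^-1)).
  by rewrite ler_wpM2r ?invr_ge0// lerDl.
rewrite mulrC -ltr_pdivlMr ?ltr_wpDl//.
apply: (@le_lt_trans _ _ n.+1%:R^-1).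
  by rewrite lef_pV2 ?posrE// ler_nat ltnS leq_addr.
by near: n; exact: (near_infty_natSinv_lt (PosNum bC0)).
Unshelve. all: by end_near. Qed.

End compactness.

(** * Limits and total boundedness from a precompact core *)

Section precompact_core_theory.
Context {R : realType} (omega : set_system nat) {UF : UltraFilter omega}.
Hypothesis nonprincipal_omega : forall n : nat, ~ omega [set n].

Lemma nonprincipal_ge n : omega [set i | (n <= i)%N].
Proof.
elim: n => [|n IH]; first by apply: (@filterS _ omega _ setT) => //; exact: filterT.
have [/nonprincipal_omega//|] := in_ultra_setVsetC (F := omega) [set n].
move=> ne; apply: (@filterS _ omega _ _ _ _ (filterI IH ne)) => i [/= ni /eqP in'].
by rewrite ltn_neqAle eq_sym in' ni.
Qed.

Context (X : nat -> pmms R) (A : forall i, set (X i)).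
Hypothesis core : precompact_core omega A.

Lemma precompact_core_cvg : exists (Y : pmms R) (k : nat -> nat),
  [/\ boundedly_finite (pmeas Y), spt (pmeas Y) (basept Y),
    forall n, (k n < k n.+1)%N & wpmGH_cvg (fun n => X (k n)) Y].
Proof.
have [M [z [zA z_le z_base z_net]]] := exists_net_points core.
have [nu [D [code [D_borel nuD code_gt0 wtP]]]] :=
  tree_coding (cell_weight_ge0 core M z) (cell_weight_tree core M z).
exact: (precompact_limit core zA z_le z_base z_net D_borel nuD code_gt0 wtP
  nonprincipal_ge).
Qed.

(** A net of level n, with 1/(n+1) < r and rho < n + 1, misses only points outside [A i]. Their mass
    tends to 0, so the same centres serve for every eps. *)
Lemma precompact_core_totally_bounded : asymp_totally_bounded omega X.
Proof.
split=> [rho rho0|rho r e rho0 r0 e0].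
  have [eta etaP] := core_mass core (Num.bound rho).
  exists eta; apply: (@filterS _ omega _ _ _ _ etaP) => i /=; apply: le_trans.
  apply: le_mball; [exact: ball_borel..|apply: sub_ball_radius].
  by apply/ltW/archi_boundP/ltW.
have [M [z [_ _ _ z_net]]] := exists_net_points core.
have [N _ /(_ _ (leq_maxl N (Num.bound rho))) /= nr] := near_infty_natSinv_lt (PosNum r0).
set n := maxn N (Num.bound rho) in nr.
have rhon : rho < n.+1%:R.
  rewrite (lt_le_trans (archi_boundP (ltW rho0)))// ler_nat.
  by rewrite (leq_trans (leq_maxr N _)).
exists (M n), (fun i l => z n l i).
set f := fun i => pmeas (X i) _.
have f_le b : 0 < b -> omega [set i | (f i <= b%:E)%E].
  move=> b0; apply: (@filterS _ omega _ _ _ _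
    (filterI (z_net n) (core_full core n.+1 b0))) => i /= [cov].
  apply: le_trans; apply: le_mball.
  - apply: (@measurableD _ (borel (X i))).
      apply: closed_borel; rewrite -[cball _ _]setCK; apply: open_closedC.
      apply/open_ballP => x /= /negP; rewrite -ltNge => far.
      exists (mdist (basept (X i)) x - rho); first by rewrite subr_gt0.
      move=> y /in_ball xy /=; apply/negP; rewrite -ltNge.
      by have := metric_triangle (basept (X i)) y x; rewrite (metric_sym y x); lra.
    by apply: open_borel; apply: bigcup_open => l _; exact: metric_ball_open.
  - by apply: (@measurableD _ (borel (X i))); [exact: ball_borel|exact: core_borel core i].
  move=> x [/= px ncov]; split; first by apply/in_ball; exact: le_lt_trans px rhon.
  move=> Ax; apply: ncov.
  have [|l lM lx] := cov x Ax; first by apply/in_ball; exact: le_lt_trans px rhon.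
  by exists (Ordinal lM) => //=; exact: sub_ball_radius (ltW nr) _ lx.
suff f0 : f @ omega --> 0%E by rewrite (cvg_lim _ f0)// lee_fin ltW.
apply/fine_cvgP; split.
  apply: (@filterS _ omega _ _ _ _ (f_le 1 ltr01)) => i /= fi.
  by rewrite ge0_fin_numE// (le_lt_trans fi)// ltry.
apply/cvgrPdist_le => b b0; apply: (@filterS _ omega _ _ _ _ (f_le b b0)) => i /= fi.
rewrite sub0r normrN ger0_norm ?fine_ge0// -lee_fin fineK//.
by rewrite ge0_fin_numE// (le_lt_trans fi)// ltry.
Qed.

End precompact_core_theory.

(** * Blow-ups at a density point *)

Section blowup_core.
Context {R : realType} {X : polishMetricType R}.
Variable m : {measure set (borel X) -> \bar R}.
Hypothesis m_finite : boundedly_finite m.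

Lemma scaled_ball (c : {posnum R}) (x : X) (e : R) :
  @ball R (scaled c X) x e = @ball R X x (e * c%:num).
Proof.
rewrite !ballEmdist; apply/seteqP; split=> y /=;
  by rewrite -[@mdist R (scaled c X) x y]/(@mdist R X x y / c%:num) ltr_pdivrMr.
Qed.

Variables (p : X) (p_spt : spt m p).

Let mass_gt0 (s : {posnum R}) : 0 < fine (m (ball p s%:num)).
Proof. by rewrite fine_gt0// p_spt//= m_finite. Qed.

Let mass_fin (s : {posnum R}) : m (ball p s%:num) \is a fin_num.
Proof. by apply: (mball_fin m_finite (ball_borel p s%:num)); exact: subset_refl. Qed.

Lemma pmeas_blowup_le (s : {posnum R}) (B : set X) (K : R) :
  (m B <= K%:E * m (ball p s%:num))%E -> (pmeas (blowup m p s) B <= K%:E)%E.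
Proof.
move=> BK; rewrite -[pmeas _ _]/((fine (m (ball p s%:num)))^-1%:E * m B)%E.
apply: (@le_trans _ _ ((fine (m (ball p s%:num)))^-1%:E * (K%:E * m (ball p s%:num)))%E).
  by rewrite lee_wpmul2l// lee_fin invr_ge0 fine_ge0.
rewrite -{2}(fineK (mass_fin s)) -!EFinM lee_fin mulrCA mulVf ?mulr1//.
by rewrite gt_eqF.
Qed.

Lemma pmeas_blowup_ge (s : {posnum R}) (B : set X) (c : R) :
  (c%:E * m (ball p s%:num) <= m B)%E -> (c%:E <= pmeas (blowup m p s) B)%E.
Proof.
move=> cB; rewrite -[pmeas _ _]/((fine (m (ball p s%:num)))^-1%:E * m B)%E.
apply: (@le_trans _ _ ((fine (m (ball p s%:num)))^-1%:E * (c%:E * m (ball p s%:num)))%E).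
  rewrite -{2}(fineK (mass_fin s)) -!EFinM lee_fin mulrCA mulVf ?mulr1//.
  by rewrite gt_eqF.
by rewrite lee_wpmul2l// lee_fin invr_ge0 fine_ge0.
Qed.

Variables (C delta : R) (A : set X).
Hypotheses (C0 : 0 <= C) (delta0 : 0 < delta) (closedA : closed A).
Hypothesis A_doubling : A `<=` doubling_set m C delta.
Hypotheses (Ap : A p) (p_density : density_point m A p).
Variables (omega : set_system nat) (UF : UltraFilter omega).
Hypothesis nonprincipal_omega : forall n : nat, ~ omega [set n].
Variable r : nat -> {posnum R}.
Hypothesis r_cvg0 : (r i)%:num @[i --> \oo] --> (0 : R).

Let small d : 0 < d -> omega [set i | 0 < (r i)%:num < d].
Proof.
move=> d0; have /cvgrPdist_lt/(_ _ d0)[N _ NP] := r_cvg0.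
apply: (@filterS _ omega _ _ _ _ (nonprincipal_ge nonprincipal_omega N)) => i /= Ni.
by have := NP i Ni; rewrite /= sub0r normrN gtr0_norm// => ->; rewrite andbT.
Qed.

(** One closed set [A] is the core at all scales. The volume estimates hold below a threshold, and
    [r i] is below it for omega-a.e. i because omega is nonprincipal. *)
Lemma blowup_core :
  @precompact_core R omega (fun i => blowup m p (r i)) (fun i => A).
Proof.
split.
- by [].
- by move=> i; exact: closed_borel.
- move=> n; have [K K0 [d d0 Kd]] := ball_growth C0 delta0 A_doubling Ap n%:R.
  exists K; apply: (@filterS _ omega _ _ _ _ (small d0)) => i /= id.
  by rewrite scaled_ball; apply: pmeas_blowup_le; exact: Kd.
- move=> n; have n0 : 0 < n.+1%:R :> R by [].
  have n0' : 0 < n.+1%:R^-1 :> R by rewrite invr_gt0.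
  have [M [d d0 dP]] := ball_nets m_finite C0 delta0 A_doubling Ap p_spt n0 n0'.
  exists M; apply: (@filterS _ omega _ _ _ _ (small d0)) => i /= id.
  have [z [zA zcov]] := dP _ id; exists z; split=> // x Ax; rewrite !scaled_ball => px.
  by have [l lM lx] := zcov x Ax px; exists l => //; rewrite scaled_ball.
- move=> n e e0; have n0 : 0 < n.+1%:R :> R by [].
  have [d d0 dP] := complement_decay C0 delta0 A_doubling Ap p_density n0 e0.
  apply: (@filterS _ omega _ _ _ _ (small d0)) => i /= id.
  rewrite scaled_ball; apply: pmeas_blowup_le; apply: le_trans (dP _ id).
  apply: le_mball.
  + by apply: (@measurableD _ (borel X)); [exact: ball_borel|exact: closed_borel].
  + by apply: (@measurableD _ (borel X)); [exact: ball_borel|exact: closed_borel].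
  + by move=> x [px nAx]; split=> //; apply: sub_ball_radius px; rewrite ler_pM2r// ler_nat.
- move=> e e0; have [c c0 [d d0 dP]] := ball_decay C0 delta0 A_doubling Ap e0.
  exists c => //; apply: (@filterS _ omega _ _ _ _ (small d0)) => i /= id.
  by rewrite scaled_ball; apply: pmeas_blowup_ge; exact: dP.
Qed.

End blowup_core.

Theorem theoremB5 (R : realType)
    (omega : set_system nat) (ultra_omega : UltraFilter omega)
    (nonprincipal_omega : forall n : nat, ~ omega [set n])
    (X : polishMetricType R) (m : {measure set (borel X) -> \bar R})
    (m_finite : boundedly_finite m) (m_doubling : pointwise_doubling m)
    (r : nat -> {posnum R})
    (r_decr : nonincreasing_seq (fun i => (r i)%:num))
    (r_cvg0 : (r i)%:num @[i --> \oo] --> 0) :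
  {ae m, forall p : X,
    spt m p /\ asymp_totally_bounded omega (fun i => blowup m p (r i))} /\
  {ae m, forall p : X, spt m p /\ Tan m p !=set0}.
Proof.
have ae_core : {ae m, forall p : X, spt m p /\ exists A : set X,
    @precompact_core R omega (fun i => blowup m p (r i)) (fun i => A)}.
  pose A (k : nat) := doubling_set m k.+1%:R k.+1%:R^-1.
  have cA k : closed (A k) by exact: closed_doubling_set.
  (* The exceptional null set is taken for all k at once, since the k with [A k p] depends on
     [p]. *)
  have dens : {ae m, forall p : X, forall k, A k p -> density_point m (A k) p}.
    apply: ae_foralln => k.
    by apply: (@ae_density _ _ _ m_finite k.+1%:R k.+1%:R^-1) => //; rewrite invr_gt0.
  apply: ae_conseq (ae_spt m) _; last first.
    apply: ae_conseq (ae_doubling_set m_finite m_doubling) dens.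
    by move=> p; exact: conj.
  move=> p p_spt [[k Akp] dp]; split=> //; exists (A k).
  have k0 : 0 < k.+1%:R^-1 :> R by rewrite invr_gt0.
  exact: (blowup_core m_finite p_spt (ler0n _ _) k0 (cA k) (@subset_refl _ _)
    Akp (dp k Akp) ultra_omega nonprincipal_omega r_cvg0).
split; apply: (ae_conseq _ ae_core ae_core) => p [p_spt [A core]] _; split=> //.
  exact: precompact_core_totally_bounded core.
have [Y [k [Y_fin Y_spt k_incr k_cvg]]] := precompact_core_cvg nonprincipal_omega core.
(* The tangent is reached along a subsequence of the given scales, which still decreases to 0. *)
exists Y; split=> //; exists (r \o k); split=> //.
  move=> a b /subnKC <-; apply: r_decr.
  elim: (b - a)%N => [|c IH]; first by rewrite addn0.
  by rewrite addnS (leq_trans IH)// ltnW.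
have k_ge n : (n <= k n)%N by elim: n => // n IH; exact: leq_ltn_trans IH (k_incr n).
apply/cvgrPdist_lt => e e0; have /cvgrPdist_lt/(_ _ e0)[N _ NP] := r_cvg0.
by exists N => // n /= Nn; apply: NP => /=; exact: leq_trans Nn (k_ge n).
Qed.
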